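(* Assume that $Z_i\le Z$ for all $1\le i\le n$. Then for every real number $q\ge 2$, $$\|(Z-\mathbb{E}[Z])_+\|_q\le\sqrt{\kappa_q\, q\,\|V\|_{q/2}}\le\sqrt{\kappa q\,\|V\|_{q/2}} .$$
   Context: Let $X_1,\dots,X_n$ be independent random variables taking values in a measurable space $\mathcal{X}$, let $F:\mathcal{X}^n\to\mathbb{R}$ be measurable, and let $Z=F(X_1,\dots,X_n)$, assumed integrable so that $\mathbb{E}[Z]$ is defined. For each $i$, $Z_i=F_i(X_1,\dots,X_{i-1},X_{i+1},\dots,X_n)$ where $F_i:\mathcal{X}^{n-1}\to\mathbb{R}$ is an arbitrary measurable function. Put $V=\sum_{i=1}^n(Z-Z_i)^2$. Write $x_+=\max(x,0)$ and, for $q>0$, $\|Y\|_q=(\mathbb{E}|Y|^q)^{1/q}$ (possibly $+\infty$). For real $q\ge2$, $\kappa_q=\frac12\bigl(1-(1-\frac1q)^{q/2}\bigr)^{-1}$, and $\kappa=\frac{\sqrt e}{2(\sqrt e-1)}<1.271$. *)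

(* Defs.v *)
From HB Require Import structures.
From mathcomp Require Import all_boot all_order all_algebra.
From mathcomp Require Import all_classical all_reals all_analysis.

Set Implicit Arguments.
Unset Strict Implicit.
Unset Printing Implicit Defensive.

Import Order.TTheory GRing.Theory Num.Theory.
Import numFieldNormedType.Exports.

Local Open Scope classical_set_scope.
Local Open Scope ring_scope.

(* Mutual independence of a finite family, stated as the product rule over
   every subfamily [J]; not merely pairwise independence. *)
Definition independent_RVs (d d' : measure_display) (Omega : measurableType d)
    (E : measurableType d') (R : realType) (P : probability Omega R) (n : nat)
    (X : 'I_n -> {RV P >-> E}) : Prop :=
  forall (J : {set 'I_n}) (A : 'I_n -> set E),
    (forall j, measurable (A j)) ->
    P (\bigcap_(j in [set` J]) X j @^-1` A j) =
      (\prod_(j in J) P (X j @^-1` A j))%E.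

Definition joint (Omega E : Type) (n : nat) (X : 'I_n -> Omega -> E)
    (w : Omega) : n.-tuple E :=
  [tuple X j w | j < n].

(* [lift i] enumerates in increasing order the indices different from [i], so
   this is (X_1, .., X_(i-1), X_(i+1), .., X_n). *)
Definition joint_without (Omega E : Type) (n : nat) (X : 'I_n -> Omega -> E)
    (i : 'I_n) (w : Omega) : n.-1.-tuple E :=
  [tuple X (lift i j) w | j < n.-1].

Definition kappa_ (R : realType) (q : R) : R :=
  2^-1 * (1 - (1 - q^-1) `^ (q / 2))^-1.

Definition kappa (R : realType) : R :=
  Num.sqrt (expR 1) / (2 * (Num.sqrt (expR 1) - 1)).

(* Main.v *)
Require Import Defs.
From HB Require Import structures.
From mathcomp Require Import all_boot all_order all_algebra.
From mathcomp Require Import all_classical all_reals all_analysis.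
From mathcomp Require Import measurable_realfun ring lra.

Set Implicit Arguments.
Unset Strict Implicit.
Unset Printing Implicit Defensive.

Import Order.TTheory GRing.Theory Num.Theory.
Import numFieldNormedType.Exports.

Local Open Scope classical_set_scope.
Local Open Scope ring_scope.

(** Why the inequality holds.

    Fix [p] in ]1, 2] and let [D (a, b) = a^p - p a b^(p-1) + (p-1) b^p] be the
    Bregman divergence of [x^p].  Everything rests on its joint convexity, in
    the form of supporting planes ([breg_tangent]), which gives Jensen's
    inequality [D (E f, E c) <= E D (f, c)].

    Tensorization ([entropy_tensorization]).  Integrate out the coordinates of
    [f (X_1, .., X_n)] one at a time, going from [f] down to the constant
    [E f].  Averaging the current function [g] over the coordinate [i] lowers
    [E g^p] by at most [E D (g, h)], for every [h] that ignores [X_i]: the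
    difference is [E D (E_i g, h) >= 0].  Take for [h] the average, over the
    coordinates already integrated out, of a function [c_i] that ignores [X_i];
    by Jensen the loss is then at most [E D (f, c_i)].  Summing,
    [E f^p - (E f)^p <= sum_i E D (f, c_i)].

    Recursion on moments ([moment_recursion]).  With [m = E Z], take
    [f = y^(q-1)] and [c_i = x_i^(q-1)], where [y = max (Z - m, e)] and
    [x_i = max (Z_i - m, e)] for a small level [e > 0], and [p = q / (q - 1)].
    Since [x_i <= y], a second-order Taylor bound gives
    [D (f, c_i) <= q/2 (y - x_i)^2 y^(q-2)], hence
    [E y^q <= (E y^(q-1))^(q/(q-1)) + q/2 E (V y^(q-2))].
    For [p = 2] the tensorization is the Efron-Stein inequality
    ([efron_stein]), which bounds [E y^2].

    Solving the recursion ([moment_step], [moment_bound]).  Descending from [q]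
    by unit steps to the second moment, one gets
    [E y^q <= (kappa_q q B)^(q/2)] as soon as [E V^(q/2) <= B^(q/2)] and
    [E y^2 <= B].  The mixed term is absorbed by Young's inequality, and
    [kappa_q] is precisely the constant for which the bound reproduces itself,
    because [1 / (2 kappa_q) = 1 - (1 - 1/q)^(q/2)].  That [kappa_q] is
    nondecreasing is Bernoulli's inequality, and [kappa] bounds it because
    [1 - 1/q <= e^(-1/q)].

    All this is done for bounded functions, so that every integral is finite.
    The level [e] then tends to 0 ([moment_inequality_bounded]), and a general
    [Z] is reached by clipping [Z] and the [Z_i] to [-k, k], which preserves
    [Z_i <= Z] and does not increase [V]; Fatou's lemma concludes
    ([moment_inequality]). *)

(** * Real powers and the Bregman divergence of a power *)

(** Bernoulli's inequality, which is Young's inequality against the constant 1. *)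
Lemma powR_ge_tangent1 (R : realType) (a p : R) : 0 <= a -> 1 <= p ->
  1 + p * (a - 1) <= a `^ p.
Proof.
move=> a0; rewrite le_eqVlt => /predU1P[<-|p1]; first by rewrite powRr1//; lra.
have p0 : 0 < p by lra.
have q0 : 0 < (1 - p^-1)^-1 by rewrite invr_gt0 subr_gt0 invf_lt1.
have := conjugate_powR a0 ler01 p0 q0.
rewrite invrK mulr1 powR1 mul1r addrC subrK => /(_ erefl).
rewrite -(ler_pM2l p0) mulrDr mulrCA divff ?gt_eqF// mulr1.
rewrite mulrBr divff ?gt_eqF//; lra.
Qed.

Lemma powR_le_tangent1 (R : realType) (a s : R) : 0 <= a -> 0 <= s <= 1 ->
  a `^ s <= 1 + s * (a - 1).
Proof.
move=> a0 /andP[]; rewrite le_eqVlt => /predU1P[<- _|s0 s1].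
  by rewrite powRr0; lra.
have := @powR_ge_tangent1 _ (a `^ s) s^-1 (powR_ge0 _ _) _.
rewrite -powRrM divff ?gt_eqF// powRr1// => /(_ _).
rewrite invf_ge1// => /(_ s1).
by rewrite -(ler_pM2l s0) mulrDr mulrA divff ?gt_eqF//; lra.
Qed.

Lemma powR_ge1 (R : realType) (a s : R) : 1 <= a -> 0 <= s -> 1 <= a `^ s.
Proof. by move=> a1 s0; rewrite -(powRr0 a) ler_powR. Qed.

Lemma powR_le1 (R : realType) (a s : R) : 0 < a <= 1 -> 0 <= s -> a `^ s <= 1.
Proof. by move=> a01 s0; rewrite -(powRr0 a) ger_powR. Qed.

Lemma is_derive_powR (R : realType) (p x : R) : 0 < x ->
  is_derive x 1 (fun t : R => t `^ p) (p * x `^ (p - 1)).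
Proof.
move=> x0; have x0' : x \in `]0, +oo[ by rewrite in_itv/= x0.
by rewrite -(powR_derive1 p x0') derive1E; apply/derivableP/derivable_powR.
Qed.

(** The sign condition makes [f] decrease before 1 and increase after it.  It is
    asked only between [x] and 1, where the functions [f] used below are
    differentiable. *)
Lemma min_at1 (R : realType) (f df : R -> R) (x : R) :
  (forall t, Num.min x 1 <= t <= Num.max x 1 -> is_derive t 1 f (df t)) ->
  (forall t, Num.min x 1 <= t <= Num.max x 1 -> 0 <= df t * (t - 1)) ->
  f 1 <= f x.
Proof.
have mvt (a b : R) : a < b -> (forall t, a <= t <= b -> is_derive t 1 f (df t)) ->
    exists2 c, a < c < b & f b - f a = df c * (b - a).
  move=> ab fd.
  have [| |c] := @MVT R f df a b ab.
  - move=> t; rewrite in_itv/= => /andP[/ltW at_ /ltW tb].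
    by apply: fd; rewrite at_.
  - apply: derivable_within_continuous => t; rewrite in_itv/= => tab.
    by have := fd t tab => h; apply: ex_derive.
  by rewrite in_itv/=; exists c.
move=> fd s; have [x1|x1|->//] := ltgtP x 1.
- have := s; have := fd; rewrite (min_idPl (ltW x1)) (max_idPr (ltW x1)) => fd1 s1.
  have [c /andP[c1 c2] e] := mvt _ _ x1 fd1.
  have := s1 c; rewrite (ltW c1) (ltW c2) => /(_ isT).
  rewrite nmulr_lge0 ?subr_lt0// => dc; rewrite -subr_le0 e.
  by rewrite mulr_le0_ge0// subr_ge0 ltW.
- have := s; have := fd; rewrite (min_idPr (ltW x1)) (max_idPl (ltW x1)) => fd1 s1.
  have [c /andP[c1 c2] e] := mvt _ _ x1 fd1.
  have := s1 c; rewrite (ltW c1) (ltW c2) => /(_ isT).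
  rewrite pmulr_lge0 ?subr_gt0// => dc; rewrite -subr_ge0 e.
  by rewrite mulr_ge0// subr_ge0 ltW.
Qed.

(** The difference of the two sides has a derivative whose sign is given by
    Bernoulli's inequality for the exponent [q - 1]. *)
Lemma powR_le_taylor2 (R : realType) (x q : R) : 0 < x <= 1 -> 2 <= q ->
  x `^ q <= 1 + q * (x - 1) + q * (q - 1) / 2 * (x - 1) ^+ 2.
Proof.
move=> /andP[x0 x1] q2.
pose f (t : R) := 1 + q * (t - 1) + q * (q - 1) / 2 * (t - 1) ^+ 2 - t `^ q.
pose df (t : R) := q + q * (q - 1) * (t - 1) - q * t `^ (q - 1).
suff : f 1 <= f x by rewrite /f powR1; lra.
apply: (@min_at1 _ f df); rewrite (min_idPl x1) (max_idPr x1).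
  move=> t /andP[xt _]; have t0 : 0 < t by lra.
  rewrite /f /df; have := is_derive_powR q t0 => h.
  apply: is_derive_eq; rewrite /GRing.scale/=; lra.
move=> t /andP[xt t1]; rewrite /df.
have t0 : 0 <= t by lra.
have /(powR_ge_tangent1 t0) : 1 <= q - 1 by lra.
set w := t `^ _ => h.
have -> : q + q * (q - 1) * (t - 1) - q * w =
    - (q * (w - (1 + (q - 1) * (t - 1)))) by ring.
rewrite mulNr -mulrN mulr_ge0//; last by lra.
by rewrite mulr_ge0//; lra.
Qed.

(** The Bregman divergence of the convex function [x^p]. *)
Definition breg (R : realType) (p a b : R) : R :=
  a `^ p - p * (a * b `^ (p - 1)) + (p - 1) * b `^ p.

Lemma powR_ge_tangent (R : realType) (p a b : R) : 0 <= a -> 0 < b -> 1 <= p ->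
  b `^ p + p * b `^ (p - 1) * (a - b) <= a `^ p.
Proof.
move=> a0 b0 p1.
have ab0 : 0 <= a / b by rewrite divr_ge0// ltW.
have := powR_ge_tangent1 ab0 p1.
have bp0 : 0 < b `^ p by rewrite powR_gt0.
rewrite -(ler_pM2l bp0) -powRM//; last exact: ltW.
rewrite [b * _]mulrC divfK ?gt_eqF//.
apply: le_trans; rewrite le_eqVlt; apply/orP; left; apply/eqP.
have -> : b `^ p = b * b `^ (p - 1) by rewrite mulr_powRB1; lra.
by field; rewrite gt_eqF.
Qed.

Lemma breg_ge0 (R : realType) (p a b : R) : 0 <= a -> 0 < b -> 1 <= p ->
  0 <= breg p a b.
Proof.
move=> a0 b0 p1; have := powR_ge_tangent a0 b0 p1; rewrite /breg.
have -> : b `^ p = b * b `^ (p - 1) by rewrite mulr_powRB1; lra.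
lra.
Qed.

Lemma powR_chord_le (R : realType) (s l t : R) :
  1 <= s -> 0 <= t -> 0 <= l <= 1 ->
  (1 - l + l * t) `^ s <= 1 - l + l * t `^ s.
Proof.
move=> s1 t0 /andP[l0 l1].
set m := 1 - l + l * t.
have m0 : 0 <= m by rewrite /m addr_ge0 ?mulr_ge0//; lra.
move: m0; rewrite le_eqVlt => /predU1P[<-|m0].
  rewrite powR0 ?gt_eqF//; last by lra.
  by rewrite addr_ge0 ?mulr_ge0 ?powR_ge0//; lra.
have h1 := powR_ge_tangent t0 m0 s1.
have h2 := powR_ge_tangent ler01 m0 s1; rewrite powR1 in h2.
have l1' : 0 <= 1 - l by lra.
have := lerD (ler_wpM2l l0 h1) (ler_wpM2l l1' h2).
set k := s * m `^ (s - 1).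
have -> : l * (m `^ s + k * (t - m)) + (1 - l) * (m `^ s + k * (1 - m)) = m `^ s.
  by rewrite {2 4}/m; ring.
by rewrite mulr1 [_ + (1 - l)]addrC.
Qed.

(** With [p = r + 1], the supporting-plane inequality for [breg p] at [(u, 1)],
    minimised over the first variable of the divergence, reduces to a lower
    bound of this quantity by [(u^r + v^r - 1)^(1 + 1/r)] when the base is
    positive, and by 0 otherwise.  It is symmetric in the base point [u] and
    the second variable [v] of the divergence. *)
Definition breg_gap (R : realType) (r u v : R) : R :=
  u `^ (r + 1) + v `^ (r + 1) - 1 + (r + 1) * ((u - 1) * (v - 1)).

(** The left factor is, up to [r + 1], the [u]-derivative of the two sides of
    [breg_gap_ge].  Its sign comes from the convexity of [t^(1/r)]: with
    [w = u^r + v^r - 1], the point [w / u^r] divides the segment from 1 to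
    [v^r] in the ratio [u^-r] if [u >= 1]; if [u <= 1], it is [v^r] that
    divides the segment from 1 to [w / u^r], in the ratio [u^r]. *)
Lemma breg_gap_slope (R : realType) (r u v : R) :
  0 < r <= 1 -> 0 < u -> 0 < v -> 0 < u `^ r + v `^ r - 1 ->
  0 <= (u `^ r + v - 1 - (u `^ r + v `^ r - 1) `^ r^-1 * u `^ (r - 1)) * (u - 1).
Proof.
move=> /andP[r0 r1] u0 v0 w0.
have rinv1 : 1 <= r^-1 by rewrite invf_ge1.
have p0 : 0 < r + 1 by lra.
set x := u `^ r; set y := v `^ r; set w := x + y - 1.
have x0 : 0 < x by rewrite powR_gt0.
have y0 : 0 < y by rewrite powR_gt0.
have xE : x `^ r^-1 = u by rewrite /x -powRrM divff ?gt_eqF// powRr1// ltW.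
have yE : y `^ r^-1 = v by rewrite /y -powRrM divff ?gt_eqF// powRr1// ltW.
have -> : w `^ r^-1 * u `^ (r - 1) = x * (w / x) `^ r^-1.
  have -> : w `^ r^-1 = u * (w / x) `^ r^-1.
    rewrite -[in RHS]xE -powRM ?divr_ge0 1?ltW//.
    by rewrite [_ * (w / x)]mulrC divfK// gt_eqF.
  by rewrite mulrAC mulr_powRB1// ltW.
have [u1|u1] := leP 1 u.
  apply: mulr_ge0; last by rewrite subr_ge0.
  have x1 : 1 <= x by apply: powR_ge1 => //; exact: ltW.
  have l01 : 0 <= x^-1 <= 1 by rewrite invr_ge0 invf_le1// x1 ltW.
  have := powR_chord_le rinv1 (ltW y0) l01.
  have -> : 1 - x^-1 + x^-1 * y = w / x by rewrite /w; field; rewrite gt_eqF.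
  rewrite -(ler_pM2l x0) yE.
  have -> : x * (1 - x^-1 + x^-1 * v) = x - 1 + v by field; rewrite gt_eqF.
  by rewrite subr_ge0 addrAC.
apply: mulr_le0; last by rewrite subr_le0 ltW.
have x1 : x <= 1 by apply: powR_le1; rewrite ?u0/= ltW.
have l01 : 0 <= x <= 1 by rewrite ltW.
have wx0 : 0 <= w / x by rewrite divr_ge0// ltW.
have := powR_chord_le rinv1 wx0 l01.
have -> : 1 - x + x * (w / x) = y by rewrite /w; field; rewrite gt_eqF.
rewrite yE subr_le0 (_ : x + v - 1 = v - (1 - x)); last by ring.
by rewrite lerBlDl.
Qed.

(** There is equality at [u = 1], and [u = 1] is a minimum of the difference by
    [breg_gap_slope]. *)
Lemma breg_gap_ge (R : realType) (r u v : R) :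
  0 < r <= 1 -> 0 < u -> 0 < v -> 0 < u `^ r + v `^ r - 1 ->
  (u `^ r + v `^ r - 1) `^ (r^-1 + 1) <= breg_gap r u v.
Proof.
move=> r01 u0 v0 w0; have /andP[r0 r1] := r01.
have p0 : 0 < r + 1 by lra.
pose f (t : R) := breg_gap r t v - (t `^ r + v `^ r - 1) `^ (r^-1 + 1).
pose df (t : R) := (r + 1) *
  (t `^ r + v - 1 - (t `^ r + v `^ r - 1) `^ r^-1 * t `^ (r - 1)).
suff : f 1 <= f u.
  rewrite /f /breg_gap !powR1 subrr mul0r mulr0.
  have -> : 1 + v `^ r - 1 = v `^ r by ring.
  rewrite -powRrM mulrDr divff ?gt_eqF// mulr1 [1 + r]addrC; lra.
have key t : Num.min u 1 <= t <= Num.max u 1 -> 0 < t /\ 0 < t `^ r + v `^ r - 1.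
  move=> /andP[t1 _].
  have t0 : 0 < t by apply: lt_le_trans t1; rewrite lt_min u0/=.
  split=> //; have [ut|tu] := leP u t.
    suff : u `^ r <= t `^ r by lra.
    by apply: ge0_ler_powR => //; rewrite ?nnegrE ltW.
  have t1' : 1 <= t by move: t1; rewrite ge_min leNgt tu.
  have : 1 <= t `^ r by apply: powR_ge1 => //; exact: ltW.
  by have := powR_gt0 r v0; lra.
apply: (@min_at1 _ f df) => t /key[t0 wt0]; last first.
  rewrite /df -mulrA; by apply: mulr_ge0; [exact: ltW|exact: breg_gap_slope].
rewrite /f /df /breg_gap.
have d1 := is_derive_powR (r + 1) t0.
have d2 : is_derive t 1 (fun s : R => s `^ r + v `^ r - 1) (r * t `^ (r - 1)).
  have := is_derive_powR r t0 => h.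
  by apply: is_derive_eq; rewrite ?addr0 ?subr0.
have d3 : is_derive t 1 (fun s : R => (s `^ r + v `^ r - 1) `^ (r^-1 + 1))
   ((r^-1 + 1) * (t `^ r + v `^ r - 1) `^ (r^-1 + 1 - 1) * (r * t `^ (r - 1))).
  have h := is_derive_powR (r^-1 + 1) wt0.
  exact: (@is_derive1_comp R (fun x => x `^ (r^-1 + 1)) _ t _ _ h d2).
apply: is_derive_eq; rewrite /GRing.scale/= !addrK.
by field; rewrite gt_eqF.
Qed.

(** For fixed [v < 1] the gap is convex in [u] with its minimum at
    [u^r = 1 - v]; there [u^r + v^r - 1 = v^r - v] is positive, so that
    [breg_gap_ge] applies.  For [r = 1] this last quantity vanishes, but the
    gap is then a square. *)
Lemma breg_gap_ge0 (R : realType) (r u v : R) :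
  0 < r <= 1 -> 0 < u -> 0 < v -> 0 <= breg_gap r u v.
Proof.
move=> r01 u0 v0; have /andP[r0 r1] := r01.
have [r1'|] := ltP r 1; last first.
  move=> r1'; have rE : r = 1 by lra.
  rewrite /breg_gap rE -[1 + 1]/(2%:R) !powR_mulrn ?(ltW u0) ?(ltW v0)//.
  suff -> : u ^+ 2 + v ^+ 2 - 1 + 2 * ((u - 1) * (v - 1)) = (u + v - 1) ^+ 2.
    exact: sqr_ge0.
  by ring.
have pos u' v' : 0 < u' -> 0 < v' -> 0 < u' `^ r + v' `^ r - 1 ->
    0 <= breg_gap r u' v'.
  move=> u'0 v'0 w0; apply: le_trans (breg_gap_ge r01 u'0 v'0 w0).
  exact: powR_ge0.
have [v1|v1] := leP 1 v.
  apply: pos => //; suff : 1 <= v `^ r by have := powR_gt0 r u0; lra.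
  by apply: powR_ge1 => //; exact: ltW.
(* the minimiser of the gap in its first argument *)
pose u' := (1 - v) `^ r^-1.
have u'0 : 0 < u' by rewrite powR_gt0; lra.
have u'r : u' `^ r = 1 - v by rewrite /u' -powRrM mulVf ?gt_eqF// powRr1; lra.
have : 0 <= breg_gap r u' v.
  apply: pos => //; rewrite u'r.
  suff : v < v `^ r by lra.
  rewrite -{1}(powRr1 (ltW v0)) /powR gt_eqF// ltr_expR.
  by rewrite ltr_nM2r// -ln1 ltr_ln// posrE.
have p1 : 1 <= r + 1 by lra.
have := powR_ge_tangent (ltW u0) u'0 p1; rewrite addrK u'r /breg_gap; lra.
Qed.

(** Young's inequality eliminates [a] and leaves [breg_gap_ge]; when
    [u^r + b^r - 1 <= 0] the terms in [a] are nonnegative and [breg_gap_ge0]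
    suffices. *)
Lemma breg_tangent_at1 (R : realType) (r a b u : R) :
  0 < r <= 1 -> 0 < a -> 0 < b -> 0 < u ->
  breg (r + 1) u 1 + (r + 1) * (u `^ r - 1) * (a - u) +
    (r + 1) * r * (1 - u) * (b - 1) <= breg (r + 1) a b.
Proof.
move=> r01 a0 b0 u0; have /andP[r0 r1] := r01.
have p0 : 0 < r + 1 by lra.
rewrite /breg !powR1 !addrK.
have uE : u `^ (r + 1) = u * u `^ r.
  by rewrite -(@mulr_powRB1 _ u (r + 1)) ?addrK//; lra.
rewrite uE.
have h := breg_gap_ge0 r01 u0 b0; have hw := breg_gap_ge r01 u0 b0.
rewrite /breg_gap in h hw.
rewrite uE in h hw.
suff : 0 <= a `^ (r + 1) - (r + 1) * (a * (u `^ r + b `^ r - 1)) +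
   r * (u * u `^ r + b `^ (r + 1) - 1 + (r + 1) * ((u - 1) * (b - 1))) by lra.
have [w0|w0] := leP (u `^ r + b `^ r - 1) 0.
  have h1 := powR_ge0 a (r + 1).
  have h2 : 0 <= (r + 1) * (a * - (u `^ r + b `^ r - 1)).
    by rewrite !mulr_ge0//; lra.
  by have := mulr_ge0 (ltW r0) h; lra.
have {hw} := hw w0; rewrite -[_ <= _ + _](ler_pM2l r0).
set w := u `^ r + b `^ r - 1 in w0 *.
have q0 : 0 < r^-1 + 1 by rewrite addr_gt0// invr_gt0.
have := @conjugate_powR R a w (r + 1) (r^-1 + 1) (ltW a0) (ltW w0) p0 q0.
have -> : (r + 1)^-1 + (r^-1 + 1)^-1 = 1.
  by field; rewrite !gt_eqF//=; lra.
move=> /(_ erefl) young; move: young; rewrite -[a * w <= _](ler_pM2l p0).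
have -> : (r + 1) * (a `^ (r + 1) / (r + 1) + w `^ (r^-1 + 1) / (r^-1 + 1)) =
  a `^ (r + 1) + r * w `^ (r^-1 + 1).
  by field; rewrite !gt_eqF//=; lra.
lra.
Qed.

Lemma bregZ (R : realType) (p c a b : R) : 0 < c -> 0 < a -> 0 < b -> 0 < p ->
  breg p (c * a) (c * b) = c `^ p * breg p a b.
Proof.
move=> c0 a0 b0 p0; rewrite /breg !powRM ?ltW//.
by rewrite -(mulr_powRB1 (ltW c0) p0); ring.
Qed.

(** Joint convexity of the Bregman divergence of [x^p] for [1 < p <= 2], as the
    existence of a supporting plane at each point; it follows by homogeneity
    from the case [z = 1]. *)
Lemma breg_tangent (R : realType) (p u z : R) : 1 < p <= 2 -> 0 < u -> 0 < z ->
  exists A B, forall a b, 0 < a -> 0 < b ->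
    breg p u z + A * (a - u) + B * (b - z) <= breg p a b.
Proof.
move=> /andP[p1 p2] u0 z0.
have p0 : 0 < p by lra.
have r01 : 0 < p - 1 <= 1 by lra.
pose A := p * ((u / z) `^ (p - 1) - 1).
pose B := p * (p - 1) * (1 - u / z).
exists (z `^ p * A / z), (z `^ p * B / z) => a b a0 b0.
have zE c : c = z * (c / z) by rewrite mulrC divfK// gt_eqF.
have dz0 c : 0 < c -> 0 < c / z by move=> c0; rewrite divr_gt0.
have := breg_tangent_at1 r01 (dz0 _ a0) (dz0 _ b0) (dz0 _ u0).
rewrite subrK -/A -/B -(ler_pM2l (powR_gt0 p z0)) -bregZ ?dz0// -!zE.
rewrite mulrDr mulrDr -bregZ ?dz0// -zE mulr1.
apply: le_trans; rewrite le_eqVlt; apply/orP; left; apply/eqP.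
by field; rewrite gt_eqF.
Qed.

(** After division by [y^q] this is the Taylor bound [powR_le_taylor2] at
    [x / y]. *)
Lemma breg_powR_le (R : realType) (q x y : R) : 2 <= q -> 0 < x <= y ->
  breg (q / (q - 1)) (y `^ (q - 1)) (x `^ (q - 1)) <=
  q / 2 * ((y - x) ^+ 2 * y `^ (q - 2)).
Proof.
move=> q2 /andP[x0 xy]; have y0 : 0 < y by lra.
have q10 : q - 1 != 0 by rewrite gt_eqF//; lra.
have e1 : q / (q - 1) - 1 = (q - 1)^-1 by field.
rewrite /breg e1 -!powRrM divff// powRr1; last exact: ltW.
rewrite [(q - 1) * (q / _)]mulrCA divff// mulr1.
have xy01 : 0 < x / y <= 1 by rewrite divr_gt0//= ler_pdivrMr// mul1r.
have := powR_le_taylor2 xy01 q2.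
have yq : 0 < y `^ q by rewrite powR_gt0.
have -> : x `^ q = y `^ q * (x / y) `^ q.
  rewrite -powRM ?divr_ge0 ?(ltW x0) ?(ltW y0)//.
  by rewrite [y * _]mulrC divfK ?gt_eqF.
rewrite -(ler_pM2l yq); set xyq := y `^ q * (x / y) `^ q.
have -> : y `^ q = y ^+ 2 * y `^ (q - 2).
  rewrite -(powR_mulrn 2 (ltW y0)) -powRD ?(gt_eqF y0) ?implybT//.
  by congr (_ `^ _); ring.
have -> : y `^ (q - 1) = y * y `^ (q - 2).
  rewrite -{2}(powRr1 (ltW y0)) -powRD ?(gt_eqF y0) ?implybT//.
  by congr (_ `^ _); ring.
have k0 : 0 < (q - 1)^-1 by rewrite invr_gt0; lra.
rewrite -(ler_pM2l k0) => h.
set Y := y `^ (q - 2) in h *.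
rewrite -subr_ge0; rewrite -subr_ge0 in h.
apply: le_trans h _; rewrite le_eqVlt; apply/orP; left; apply/eqP.
by field; rewrite q10 gt_eqF.
Qed.

(** * Bounded measurable functions, and replacement of a coordinate of a tuple *)

Section bounded_measurable.
Context d (T : measurableType d) (R : realType).
Implicit Types f g : T -> R.

(** The class in which all intermediate integrals are taken: it is stable under
    the operations used below and its members are integrable for every
    probability. *)
Definition bmf (f : T -> R) : Prop :=
  measurable_fun setT f /\ exists B, forall t, `|f t| <= B.

Lemma bmf_cst (c : R) : bmf (fun=> c).
Proof. by split; [exact: measurable_cst|exists `|c|]. Qed.

Lemma bmfD f g : bmf f -> bmf g -> bmf (fun t => f t + g t).
Proof.
move=> [mf [B fB]] [mg [C gC]]; split; first exact: measurable_funD.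
by exists (B + C) => t; rewrite (le_trans (ler_normD _ _))// lerD.
Qed.

Lemma bmfM f g : bmf f -> bmf g -> bmf (fun t => f t * g t).
Proof.
move=> [mf [B fB]] [mg [C gC]]; split; first exact: measurable_funM.
by exists (B * C) => t; rewrite normrM ler_pM.
Qed.

Lemma bmfZ (c : R) f : bmf f -> bmf (fun t => c * f t).
Proof. exact/bmfM/bmf_cst. Qed.

Lemma bmfB f g : bmf f -> bmf g -> bmf (fun t => f t - g t).
Proof.
move=> [mf [B fB]] [mg [C gC]]; split; first exact: measurable_funB.
by exists (B + C) => t; rewrite (le_trans (ler_normB _ _))// lerD.
Qed.

Lemma bmf_powR f (s : R) : 0 <= s -> bmf f -> bmf (fun t => f t `^ s).
Proof.
move=> s0 [mf [B fB]]; split.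
  exact: (measurableT_comp (measurable_powR s) mf).
exists (1 + B `^ s) => t; rewrite ger0_norm ?powR_ge0//.
have [f0|f0] := ltP (f t) 0; first by rewrite lt0_powR1// lerDl powR_ge0.
rewrite -[leLHS]add0r lerD// ge0_ler_powR ?nnegrE//.
  by rewrite (le_trans _ (fB t)).
by rewrite (le_trans _ (fB t))// ler_norm.
Qed.

Lemma bmf_sum (I : Type) (s : seq I) (F : I -> T -> R) :
  (forall i, bmf (F i)) -> bmf (fun t => \sum_(i <- s) F i t).
Proof.
move=> hF; elim: s => [|i s ih].
  by under eq_fun do rewrite big_nil; exact: bmf_cst.
by under eq_fun do rewrite big_cons; exact: bmfD.
Qed.

Lemma bmf_breg f g (p : R) : 1 <= p -> bmf f -> bmf g ->
  bmf (fun t => breg p (f t) (g t)).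
Proof.
move=> p1 bf bg; apply: bmfD; last by apply/bmfZ/bmf_powR => //; lra.
apply: bmfB; first by apply: bmf_powR => //; lra.
by apply/bmfZ/bmfM => //; apply: bmf_powR => //; lra.
Qed.

Variable mu : probability T R.

Lemma bmf_integrable f : bmf f -> mu.-integrable setT (EFin \o f).
Proof.
move=> [mf [B fB]]; apply: measurable_bounded_integrable => //.
  by rewrite (le_lt_trans (probability_le1 mu _))// ltry.
exists B; split; first exact: num_real.
by move=> M BM t _; apply: le_trans (fB t) (ltW BM).
Qed.

Lemma integral_bmfD f g : bmf f -> bmf g ->
  \int[mu]_t (f t + g t) = \int[mu]_t f t + \int[mu]_t g t.
Proof. by move=> bf bg; rewrite RintegralD//; exact: bmf_integrable. Qed.

Lemma integral_bmfB f g : bmf f -> bmf g ->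
  \int[mu]_t (f t - g t) = \int[mu]_t f t - \int[mu]_t g t.
Proof. by move=> bf bg; rewrite RintegralB//; exact: bmf_integrable. Qed.

Lemma integral_bmfZ (c : R) f : bmf f ->
  \int[mu]_t (c * f t) = c * \int[mu]_t f t.
Proof. by move=> bf; rewrite RintegralZl//; exact: bmf_integrable. Qed.

Lemma integral_prob_cst (c : R) : \int[mu]_t c = c.
Proof.
rewrite Rintegral_cst//; have := probability_setT mu.
by move=> e; rewrite [X in fine X]e mulr1.
Qed.

Lemma integral_bmf_sum (I : Type) (s : seq I) (F : I -> T -> R) :
  (forall i, bmf (F i)) ->
  \int[mu]_t (\sum_(i <- s) F i t) = \sum_(i <- s) \int[mu]_t F i t.
Proof.
move=> hF; elim: s => [|i s ih].
  under eq_Rintegral do rewrite big_nil.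
  by rewrite integral_prob_cst big_nil.
under eq_Rintegral do rewrite big_cons.
by rewrite big_cons integral_bmfD ?ih//; exact: bmf_sum.
Qed.

Lemma le_integral_bmf f g : bmf f -> bmf g -> {ae mu, forall t, f t <= g t} ->
  \int[mu]_t f t <= \int[mu]_t g t.
Proof.
move=> bf bg fg; rewrite -subr_ge0 -integral_bmfB//.
have -> : \int[mu]_t (g t - f t) = \int[mu]_t Num.max 0 (g t - f t).
  congr fine; apply: ae_eq_integral => //.
  - by apply/measurable_EFinP; case: (bmfB bg bf).
  - apply/measurable_EFinP; apply: measurable_maxr => //.
    by case: (bmfB bg bf).
  - apply: filterS fg => t fgt _ /=; congr EFin.
    by rewrite max_r// subr_ge0.
by apply: Rintegral_ge0 => t _; rewrite le_max lexx.
Qed.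

(** The supporting plane at the pair of means, integrated.  The lower bound [a]
    keeps the means in the domain of [breg_tangent]. *)
Lemma jensen_breg f g (p a : R) : 1 < p <= 2 -> 0 < a ->
  bmf f -> bmf g -> (forall t, a <= f t) -> (forall t, a <= g t) ->
  breg p (\int[mu]_t f t) (\int[mu]_t g t) <= \int[mu]_t breg p (f t) (g t).
Proof.
move=> p12 a0 bf bg af ag.
have pos h : bmf h -> (forall t, a <= h t) -> 0 < \int[mu]_t h t.
  move=> bh ah; apply: (lt_le_trans a0); rewrite -[leLHS]integral_prob_cst.
  by apply: le_integral_bmf => //; [exact: bmf_cst|exact/aeW].
have [A [B AB]] := breg_tangent p12 (pos _ bf af) (pos _ bg ag).
set u := \int[mu]_t f t in AB *; set z := \int[mu]_t g t in AB *.
have bA : bmf (fun t => A * (f t - u)) by apply/bmfZ/bmfB => //; exact: bmf_cst.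
have bB : bmf (fun t => B * (g t - z)) by apply/bmfZ/bmfB => //; exact: bmf_cst.
have -> : breg p u z = \int[mu]_t (breg p u z + A * (f t - u) + B * (g t - z)).
  rewrite integral_bmfD//; last by apply: bmfD => //; exact: bmf_cst.
  rewrite integral_bmfD//; last exact: bmf_cst.
  rewrite !integral_bmfZ ?integral_bmfB ?integral_prob_cst//;
    try by [exact: bmf_cst|apply: bmfB => //; exact: bmf_cst].
  by rewrite !subrr !mulr0 !addr0.
apply: le_integral_bmf.
- by apply: bmfD => //; apply: bmfD => //; exact: bmf_cst.
- by apply: bmf_breg => //; lra.
- by apply/aeW => t; apply: AB; exact: lt_le_trans a0 _.
Qed.

End bounded_measurable.

Section resample.
Context d' (E : measurableType d') (n : nat).

Definition upd (i : 'I_n) (x : E) (t : n.-tuple E) : n.-tuple E :=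
  [tuple if j == i then x else tnth t j | j < n].

Lemma upd_upd i x y t : upd i y (upd i x t) = upd i y t.
Proof.
by apply: eq_from_tnth => j; rewrite !tnth_mktuple; case: eqP.
Qed.

Lemma updC i j x y t : i != j -> upd j y (upd i x t) = upd i x (upd j y t).
Proof.
move=> ij; apply: eq_from_tnth => k; rewrite !tnth_mktuple.
by have [->|//] := eqVneq k j; rewrite eq_sym (negbTE ij).
Qed.

Lemma measurable_upd i :
  measurable_fun setT (fun z : n.-tuple E * E => upd i z.2 z.1).
Proof.
apply/measurable_fun_tnthP => j /=.
rewrite (_ : _ \o _ = fun z : n.-tuple E * E => if j == i then z.2 else tnth z.1 j).
  case: (j == i); first exact: measurable_snd.
  exact: (measurableT_comp (measurable_tnth j) measurable_fst).
by apply/funext => z /=; rewrite tnth_mktuple.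
Qed.

(** A generating pi-system on which independence is the product rule. *)
Definition cylinders : set (set (n.-tuple E)) :=
  [set C | exists2 A : 'I_n -> set E, (forall j, measurable (A j)) &
     C = [set t | forall j, A j (tnth t j)]].

Lemma measurable_cylinders :
  @measurable _ (n.-tuple E) = <<s cylinders >>.
Proof.
rewrite eqEsubset; split.
  apply: smallest_sub; first exact: smallest_sigma_algebra.
  rewrite -bigcup_seq; apply: bigcup_sub => i _ _ [A mA <-].
  apply: sub_sigma_algebra.
  exists (fun j => if j == i then A else setT).
    by move=> j; case: eqP.
  apply/seteqP; split => t /=.
    by move=> [_ At] j; case: eqP => [->|].
  by move=> At; split=> //; have := At i; rewrite eqxx.
apply: smallest_sub; first exact: sigma_algebra_measurable.
move=> _ [A mA ->].
rewrite (_ : [set _ | _] =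
    \bigcap_(j in [set: 'I_n]) ((tnth (T:=E))^~ j @^-1` A j)).
  apply: fin_bigcap_measurable => // j _.
  by rewrite -[X in measurable X]setTI; exact: measurable_tnth.
by apply/seteqP; split => t /= At j; [move=> _; exact: At|exact: (At j I)].
Qed.

Lemma setI_closed_cylinders : setI_closed cylinders.
Proof.
move=> _ _ [A mA ->] [B mB ->]; exists (fun j => A j `&` B j).
  by move=> j; exact: measurableI.
apply/seteqP; split => t /=.
  by move=> [At Bt] j; split.
by move=> ABt; split => j; case: (ABt j).
Qed.

End resample.

(** * Resampling one coordinate *)

Lemma measurable_joint d d' (Omega : measurableType d) (E : measurableType d')
    n (X : 'I_n -> Omega -> E) : (forall i, measurable_fun setT (X i)) ->
  measurable_fun setT (joint X).
Proof.
move=> mX; apply/measurable_fun_tnthP => i.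
rewrite (_ : _ \o _ = X i)//.
by apply/funext => w /=; rewrite tnth_mktuple.
Qed.

Section resampling.
Context (R : realType) d d' (Omega : measurableType d) (E : measurableType d')
  (P : probability Omega R) (n : nat) (X : 'I_n -> {RV P >-> E}).
Hypothesis X_indep : independent_RVs X.

Let J : Omega -> n.-tuple E := joint X.

Let mJ : measurable_fun setT J.
Proof. by apply: measurable_joint => i; exact: measurable_funP. Qed.

Let law i : probability E R := distribution P (X i).

Let swap i (z : Omega * E) : n.-tuple E := upd i z.2 (J z.1).

Let mswap i : measurable_fun setT (swap i).
Proof.
apply: (measurableT_comp (measurable_upd i) (g := fun z => (J z.1, z.2))).
apply: measurable_fun_pair => //.
exact: (measurableT_comp mJ).
Qed.

Let m1 : {measure set _ -> \bar R} :=
  measure_function_pushforward__canonical__measure_function_Measure P mJ.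

Let m2 i : {measure set _ -> \bar R} :=
  measure_function_pushforward__canonical__measure_function_Measure
   [the measure _ _ of (P \x law i)%E] (@mswap i).

Let law_cylinder (A : 'I_n -> set E) (I : {set 'I_n}) :
  (forall j, measurable (A j)) ->
  P [set w | forall j, j \in I -> A j (X j w)] = (\prod_(j in I) law j (A j))%E.
Proof. by move=> mA; rewrite -(X_indep _ mA). Qed.

(** The law of [X] is unchanged when [X_i] is replaced by an independent copy:
    both laws give a cylinder the product of the masses of its sides. *)
Let m12 i A : measurable A -> m1 A = m2 i A.
Proof.
apply: (measure_unique (@cylinders _ E n) (fun=> setT)).
- exact: measurable_cylinders.
- exact: setI_closed_cylinders.
- by move=> _; exists (fun=> setT) => //; apply/seteqP; split.
- by rewrite bigcup_const.
- move=> _ [{}A mA ->].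
  rewrite /m1 /m2 /= /pushforward.
  pose B := [set w | forall j, j \in [set~ i]%SET -> A j (X j w)].
  have mB : measurable B.
    rewrite (_ : B = \bigcap_(j in [set j | j != i]) (X j @^-1` A j)).
      apply: fin_bigcap_measurable => [|j _]; first exact: finite_finset.
      rewrite -[X in measurable X]setTI; exact: measurable_funP.
    apply/seteqP; split => w /= h j; have := h j; rewrite !inE => hj ji;
      exact: hj.
  rewrite (_ : swap i @^-1` _ = B `*` A i); last first.
    apply/seteqP; split => -[w x] /=.
      move=> h; split.
        move=> j; rewrite !inE => ji; have := h j.
        by rewrite !tnth_mktuple (negbTE ji).
      by have := h i; rewrite tnth_mktuple eqxx.
    move=> [h Ai] j; rewrite tnth_mktuple /=.
    have [->//|ji] := eqVneq j i.
    by rewrite tnth_mktuple; apply: h; rewrite !inE.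
  rewrite product_measure1E// [X in (_ = X * _)%E](law_cylinder [set~ i]%SET mA).
  rewrite (_ : J @^-1` _ =
      [set w | forall j, j \in [set: 'I_n]%SET -> A j (X j w)]).
    rewrite law_cylinder// (bigD1 i) ?inE//= [RHS]muleC; congr (_ * _)%E.
    by apply: eq_bigl => j; rewrite !inE.
  apply/seteqP; split => w /= h j; have := h j; rewrite tnth_mktuple//.
  by apply; rewrite inE.
- move=> _; rewrite /m1/= /pushforward preimage_setT.
  by have := probability_setT P => ->; rewrite ltry.
Qed.

(** The conditional expectation given all coordinates but [i]. *)
Definition resample (i : 'I_n) (f : n.-tuple E -> R) (t : n.-tuple E) : R :=
  \int[law i]_x f (upd i x t).

Implicit Types (f g : n.-tuple E -> R) (t : n.-tuple E).

Lemma bmf_upd i f t : bmf f -> bmf (fun x => f (upd i x t)).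
Proof.
move=> [mf [B fB]]; split; last by exists B.
apply: (measurableT_comp mf).
exact: (measurable_fun_pair2 t (measurable_upd i)).
Qed.

Lemma le_resample i f g t : bmf f -> bmf g -> (forall t, f t <= g t) ->
  resample i f t <= resample i g t.
Proof.
by move=> bf bg fg; apply: le_integral_bmf; [exact: bmf_upd..|exact/aeW].
Qed.

Lemma resample_cst i (c : R) t : resample i (fun=> c) t = c.
Proof. exact: integral_prob_cst. Qed.

Lemma resample_ge i f (a : R) t : bmf f -> (forall t, a <= f t) ->
  a <= resample i f t.
Proof.
move=> bf af; rewrite -(resample_cst i a t).
by apply: le_resample => //; exact: bmf_cst.
Qed.

Lemma bmf_resample i f : bmf f -> (forall t, 0 <= f t) -> bmf (resample i f).
Proof.
move=> bf f0; have [mf [B fB]] := bf; split.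
  apply: (measurableT_comp (f := fine)) => //.
  apply: (measurable_fun_fubini_tonelli_F (m2 := law i)
    (fun z : n.-tuple E * E => (f (upd i z.2 z.1))%:E)).
  - apply/measurable_EFinP.
    exact: (measurableT_comp mf (measurable_upd i)).
  - by move=> z; rewrite lee_fin.
exists B => t; rewrite ger0_norm; last exact: resample_ge.
rewrite -(resample_cst i B t); apply: le_resample => //; first exact: bmf_cst.
by move=> u; apply: le_trans (fB u); exact: ler_norm.
Qed.

(** Averaging over one coordinate preserves expectations.  This is the only
    place where independence enters. *)
Lemma integral_resample i f : bmf f -> (forall t, 0 <= f t) ->
  \int[P]_w f (J w) = \int[P]_w resample i f (J w).
Proof.
move=> bf f0; have [mf _] := bf.
have mf' : measurable_fun setT (EFin \o f) by exact/measurable_EFinP.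
congr fine.
transitivity (\int[m1]_t (f t)%:E)%E.
  rewrite ge0_integral_pushforward//.
  by move=> t _; rewrite lee_fin.
rewrite (@eq_measure_integral _ _ _ _ (m2 i)); last by move=> A mA _; exact: m12.
rewrite ge0_integral_pushforward//; last by move=> t _; rewrite lee_fin.
rewrite preimage_setT.
rewrite (fubini_tonelli1 (fun z => (EFin \o f \o swap i) z)).
- apply: eq_integral => w _; rewrite /fubini_F /resample /Rintegral fineK//.
  exact/integrable_fin_num/bmf_integrable/bmf_upd.
- exact: (measurableT_comp mf').
- by move=> z; rewrite lee_fin.
Qed.

End resampling.

(** * Tensorization *)

Section tensorization.
Context (R : realType) d d' (Omega : measurableType d) (E : measurableType d')
  (P : probability Omega R) (n : nat) (X : 'I_n -> {RV P >-> E}).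
Hypothesis X_indep : independent_RVs X.
Implicit Types (f g : n.-tuple E -> R) (t : n.-tuple E).

Let mJ : measurable_fun setT (joint X).
Proof. by apply: measurable_joint => i; exact: measurable_funP. Qed.

Lemma bmf_joint f : bmf f -> bmf (fun w => f (joint X w)).
Proof.
move=> [mf [B fB]]; split; last by exists B.
exact: (measurableT_comp mf).
Qed.

Lemma resample_upd i f x t : resample X i f (upd i x t) = resample X i f t.
Proof. by apply: eq_Rintegral => y _; rewrite upd_upd. Qed.

(** Averaging over [j] keeps the independence from a coordinate [i], even for
    [j = i], so the list of coordinates integrated out may be arbitrary. *)
Lemma resample_updC i j f : (forall x t, f (upd i x t) = f t) ->
  forall x t, resample X j f (upd i x t) = resample X j f t.
Proof.
move=> fi x t; have [->|ij] := eqVneq j i; first exact: resample_upd.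
by apply: eq_Rintegral => y _; rewrite updC 1?eq_sym// fi.
Qed.

Lemma resampleM i f g t : bmf f -> (forall x t, g (upd i x t) = g t) ->
  resample X i (fun t => g t * f t) t = g t * resample X i f t.
Proof.
move=> bf gi; rewrite /resample.
under eq_Rintegral do rewrite gi.
by rewrite integral_bmfZ//; exact: bmf_upd.
Qed.

Definition resamples (s : seq 'I_n) f := foldr (resample X) f s.

Lemma resamples_bound s f (a : R) : 0 <= a -> bmf f -> (forall t, a <= f t) ->
  bmf (resamples s f) /\ forall t, a <= resamples s f t.
Proof.
move=> a0 bf af; elim: s => //= i s [bs as_]; split.
  by apply: bmf_resample => // t; exact: le_trans a0 _.
by move=> t; exact: resample_ge.
Qed.

Lemma resamples_invariant i s f : (forall x t, f (upd i x t) = f t) ->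
  forall x t, resamples s f (upd i x t) = resamples s f t.
Proof. by move=> fi; elim: s => //= j s ih; exact: resample_updC. Qed.

Lemma resamples_mem i s f : i \in s ->
  forall x t, resamples s f (upd i x t) = resamples s f t.
Proof.
elim: s => //= j s ih; rewrite inE => /predU1P[->|/ih {}ih].
  exact: resample_upd.
exact: resample_updC.
Qed.

(** Replace the coordinates of [t] by those of [t'] one after the other. *)
Lemma invariant_cst f : (forall i x t, f (upd i x t) = f t) ->
  forall t t', f t = f t'.
Proof.
move=> fi t t'.
pose u s := foldr (fun i v => upd i (tnth t' i) v) t s.
have uE s i : i \in s -> tnth (u s) i = tnth t' i.
  elim: s => //= j s ih; rewrite inE tnth_mktuple.
  by have [->|] := eqVneq i j.
have -> : t' = u (enum 'I_n).
  by apply: eq_from_tnth => i; rewrite uE// mem_enum.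
by rewrite /u; elim: (enum _) => //= i s ->; rewrite fi.
Qed.

Let EJ f := \int[P]_w f (joint X w).

Let EJ_resample i f : bmf f -> (forall t, 0 <= f t) -> EJ (resample X i f) = EJ f.
Proof. by move=> bf f0; rewrite /EJ -integral_resample. Qed.

Lemma integral_resamples s f : bmf f -> (forall t, 0 <= f t) ->
  EJ (resamples s f) = EJ f.
Proof.
move=> bf f0; elim: s => //= i s <-.
by have [? ?] := resamples_bound s (lexx 0) bf f0; exact: EJ_resample.
Qed.

Let le_EJ f g : bmf f -> bmf g -> (forall t, f t <= g t) -> EJ f <= EJ g.
Proof.
by move=> bf bg fg; apply: le_integral_bmf; [exact: bmf_joint..|exact/aeW].
Qed.

Lemma le_integral_breg_resamples s f g (p a : R) : 1 < p <= 2 -> 0 < a ->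
  bmf f -> bmf g -> (forall t, a <= f t) -> (forall t, a <= g t) ->
  EJ (fun t => breg p (resamples s f t) (resamples s g t)) <=
  EJ (fun t => breg p (f t) (g t)).
Proof.
move=> p12 a0 bf bg af ag; have p1 : 1 <= p by lra.
elim: s => [|i s ih]; first exact: lexx.
apply: (le_trans _ ih).
have [bf' af'] := resamples_bound s (ltW a0) bf af.
have [bg' ag'] := resamples_bound s (ltW a0) bg ag.
set f' := resamples s f in bf' af' *; set g' := resamples s g in bg' ag' *.
have bb : bmf (fun t => breg p (f' t) (g' t)) by exact: bmf_breg.
have bb0 t : 0 <= breg p (f' t) (g' t).
  by apply: breg_ge0 => //; [apply: ltW|]; exact: lt_le_trans a0 _.
rewrite -(EJ_resample i bb bb0); apply: le_EJ.
- by apply: bmf_breg => //; apply: bmf_resample => // t;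
    apply: ltW; exact: lt_le_trans a0 _.
- exact: bmf_resample.
- move=> t; rewrite /= -/f' -/g' /resample.
  exact: (jensen_breg (distribution P (X i)) p12 a0 (bmf_upd i t bf')
    (bmf_upd i t bg')).
Qed.

(** As [g] does not depend on the coordinate [i], neither [E (g^(p-1) f)] nor
    [E g^p] changes when [f] is averaged over [i].  So the two sides differ by
    the expected divergence between that average and [g], which is
    nonnegative. *)
Lemma resample_increment i f g (p a : R) : 1 < p <= 2 -> 0 < a ->
  bmf f -> bmf g -> (forall t, a <= f t) -> (forall t, a <= g t) ->
  (forall x t, g (upd i x t) = g t) ->
  EJ (fun t => f t `^ p) - EJ (fun t => resample X i f t `^ p) <=
  EJ (fun t => breg p (f t) (g t)).
Proof.
move=> p12 a0 bf bg af ag gi.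
have p1 : 1 <= p by lra.
have p0 : 0 <= p by lra.
have q0 : 0 <= p - 1 by lra.
have pos h t : (forall t, a <= h t) -> 0 < h t.
  by move=> ah; exact: lt_le_trans a0 _.
have bf' : bmf (resample X i f) by apply: bmf_resample => // t; exact/ltW/pos.
have af' t : a <= resample X i f t by exact: resample_ge.
have EJb h : bmf h -> EJ (fun t => breg p (h t) (g t)) =
    EJ (fun t => h t `^ p) - p * EJ (fun t => g t `^ (p - 1) * h t) +
    (p - 1) * EJ (fun t => g t `^ p).
  move=> bh; rewrite /EJ /breg.
  have bh' := bmf_joint bh; have bg' := bmf_joint bg.
  rewrite integral_bmfD; last 2 first.
  - apply: bmfB; first exact: bmf_powR.
    by apply/bmfZ/bmfM => //; exact: bmf_powR.
  - by apply/bmfZ; exact: bmf_powR.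
  rewrite integral_bmfB; last 2 first.
  - exact: bmf_powR.
  - by apply/bmfZ/bmfM => //; exact: bmf_powR.
  rewrite !integral_bmfZ; last 2 first.
  - exact: bmf_powR.
  - by apply/bmfM => //; exact: bmf_powR.
  by under [X in _ - p * X]eq_Rintegral do rewrite mulrC.
have cross : EJ (fun t => g t `^ (p - 1) * resample X i f t) =
    EJ (fun t => g t `^ (p - 1) * f t).
  rewrite -[RHS](@EJ_resample i); last 2 first.
  - by apply: bmfM => //; exact: bmf_powR.
  - by move=> t; rewrite mulr_ge0 ?powR_ge0//; exact/ltW/pos.
  by apply: eq_Rintegral => w _; rewrite resampleM// => x t; rewrite gi.
have : 0 <= EJ (fun t => breg p (resample X i f t) (g t)).
  rewrite -(integral_prob_cst P 0).
  apply: (@le_EJ (fun=> 0)); [exact: bmf_cst|exact: bmf_breg|].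
  by move=> t; apply: breg_ge0 => //; [exact/ltW/pos|exact: pos].
have cancel (b c e k : R) : 0 <= b - c + e -> k - b <= k - c + e.
  move=> h; rewrite -subr_ge0.
  by rewrite (_ : k - c + e - (k - b) = b - c + e)//; ring.
by rewrite (EJb _ bf') (EJb _ bf) cross; exact: cancel.
Qed.

(** Subadditivity of the [x^p]-entropy [E f^p - (E f)^p], with the conditional
    entropies already replaced by divergences to arbitrary functions [c i] that
    ignore the coordinate [i]. *)
Lemma entropy_tensorization f (c : 'I_n -> n.-tuple E -> R) (p a : R) :
  1 < p <= 2 -> 0 < a ->
  bmf f -> (forall i, bmf (c i)) ->
  (forall t, a <= f t) -> (forall i t, a <= c i t) ->
  (forall i x t, c i (upd i x t) = c i t) ->
  \int[P]_w (f (joint X w) `^ p) <= (\int[P]_w f (joint X w)) `^ p +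
    \sum_(i < n) \int[P]_w breg p (f (joint X w)) (c i (joint X w)).
Proof.
move=> p12 a0 bf bc af ac ci.
have partial s : EJ (fun t => f t `^ p) <= EJ (fun t => resamples s f t `^ p) +
    \sum_(i <- s) EJ (fun t => breg p (f t) (c i t)).
  elim: s => [|i s ih]; first by rewrite big_nil addr0.
  apply: (le_trans ih); rewrite big_cons addrA lerD2r -lerBlDl.
  have [bf' af'] := resamples_bound s (ltW a0) bf af.
  have [bc' ac'] := resamples_bound s (ltW a0) (bc i) (ac i).
  apply: le_trans (le_integral_breg_resamples s p12 a0 bf (bc i) af (ac i)).
  apply: (resample_increment p12 a0) => //.
  exact: resamples_invariant.
have := partial (enum 'I_n); rewrite big_enum/=.
set g := resamples _ f.
have gE w w' : g (joint X w) = g (joint X w').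
  by apply: invariant_cst => i x t; apply: resamples_mem; rewrite mem_enum.
have EgE (h : R -> R) w : EJ (fun t => h (g t)) = h (g (joint X w)).
  rewrite -[RHS](integral_prob_cst P); apply: eq_Rintegral => w' _.
  by rewrite (gE w' w).
have [w _] : [set: Omega] !=set0.
  apply/set0P/negP => /eqP e.
  have := probability_setT P; rewrite e measure0 => -[] /esym/eqP.
  by rewrite oner_eq0.
rewrite (EgE (fun x => x `^ p) w).
have -> : g (joint X w) = EJ f.
  rewrite -(EgE id w) integral_resamples//.
  by move=> t; exact/ltW/(lt_le_trans a0).
by [].
Qed.

End tensorization.

(** * The constants and the recursion on moments *)

Section kappa_bounds.
Context (R : realType).
Implicit Types q r : R.

(** Bernoulli's inequality for the exponent [q / r <= 1] at [1 - 1/q]. *)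
Lemma kappa_base_le q r : 2 <= q -> q <= r ->
  (1 - q^-1) `^ (q / 2) <= (1 - r^-1) `^ (r / 2).
Proof.
move=> q2 qr.
have q0 : 0 < q by lra.
have r0 : 0 < r by lra.
have qi : 0 <= 1 - q^-1 by rewrite subr_ge0 invf_le1//; lra.
have ri : 0 <= 1 - r^-1 by rewrite subr_ge0 invf_le1//; lra.
have qr01 : 0 <= q / r <= 1.
  by rewrite divr_ge0 ?(ltW q0) ?(ltW r0)//= ler_pdivrMr// mul1r.
have h : (1 - q^-1) `^ (q / r) <= 1 - r^-1.
  apply: (le_trans (powR_le_tangent1 qi qr01)).
  rewrite le_eqVlt; apply/orP; left; apply/eqP.
  by field; rewrite !gt_eqF.
have -> : q / 2 = q / r * (r / 2) by field; rewrite gt_eqF.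
by rewrite powRrM ge0_ler_powR ?nnegrE ?powR_ge0//; lra.
Qed.

Lemma kappa_base_ge q : 2 <= q -> 2^-1 <= (1 - q^-1) `^ (q / 2).
Proof.
move=> q2; have := kappa_base_le (lexx 2) q2.
by rewrite divff// powRr1; lra.
Qed.

Lemma kappa_base_le_exp q : 2 <= q ->
  (1 - q^-1) `^ (q / 2) <= (Num.sqrt (expR 1))^-1.
Proof.
move=> q2; have q0 : 0 < q by lra.
have qi : 0 <= 1 - q^-1 by rewrite subr_ge0 invf_le1//; lra.
have h : 1 - q^-1 <= expR (- q^-1) by exact: expR_ge1Dx.
have q20 : 0 <= q / 2 by lra.
have := ge0_ler_powR q20 qi (ltW (expR_gt0 _)) h.
move=> /le_trans; apply.
rewrite -powR12_sqrt ?expR_ge0// /powR !gt_eqF ?expR_gt0// !expRK -expRN.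
rewrite ler_expR le_eqVlt; apply/orP; left; apply/eqP.
by field; rewrite gt_eqF.
Qed.

Lemma sqrt_expR1_gt1 : 1 < Num.sqrt (expR 1 : R).
Proof.
by rewrite -{1}(sqrtr1 R) ltr_sqrt ?expR_gt0// expR_gt1.
Qed.

Lemma kappa_base_lt1 q : 2 <= q -> (1 - q^-1) `^ (q / 2) < 1.
Proof.
move=> /kappa_base_le_exp /le_lt_trans; apply.
by rewrite invf_lt1 ?sqrt_expR1_gt1// (lt_trans ltr01) ?sqrt_expR1_gt1.
Qed.

Lemma kappa_gt0 q : 2 <= q -> 0 < kappa_ q.
Proof.
by move=> /kappa_base_lt1 h; rewrite /kappa_ mulr_gt0 ?invr_gt0 ?subr_gt0.
Qed.

Lemma kappa_ge1 q : 2 <= q -> 1 <= kappa_ q.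
Proof.
move=> q2; have h := kappa_base_lt1 q2; have h' := kappa_base_ge q2.
rewrite /kappa_ -invfM invf_ge1; last by rewrite mulr_gt0// subr_gt0.
by lra.
Qed.

Lemma kappa_le q r : 2 <= q -> q <= r -> kappa_ q <= kappa_ r.
Proof.
move=> q2 qr; have r2 : 2 <= r by lra.
rewrite /kappa_ ler_pM2l ?invr_gt0// lef_pV2 ?posrE ?subr_gt0 ?kappa_base_lt1//.
by rewrite lerB// kappa_base_le.
Qed.

Lemma kappa_le_limit q : 2 <= q -> kappa_ q <= kappa R.
Proof.
move=> q2; have s1 := sqrt_expR1_gt1.
have s0 : 0 < Num.sqrt (expR 1 : R) by exact: lt_trans ltr01 s1.
have -> : kappa R = 2^-1 * (1 - (Num.sqrt (expR 1))^-1)^-1.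
  rewrite /kappa; field; rewrite !gt_eqF ?subr_gt0//=.
have si : (Num.sqrt (expR 1 : R))^-1 < 1 by rewrite invf_lt1.
rewrite /kappa_ ler_pM2l ?invr_gt0// lef_pV2 ?posrE ?subr_gt0 ?kappa_base_lt1//.
by rewrite lerB// kappa_base_le_exp.
Qed.

End kappa_bounds.

(** Monotonicity of L^p norms in a form free of norms: with [B] as unit, it is
    Bernoulli's inequality for the exponent [u / v] under the integral. *)
Lemma lyapunov (R : realType) d (Omega : measurableType d)
    (P : probability Omega R) (h : Omega -> R) (B u v : R) :
  bmf h -> (forall w, 0 <= h w) -> 0 < B ->
  0 <= u -> u <= v -> 0 < v ->
  \int[P]_w (h w `^ v) <= B `^ v -> \int[P]_w (h w `^ u) <= B `^ u.
Proof.
move=> bh h0 B0 u0 uv v0 hB.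
have k01 : 0 <= u / v <= 1 by rewrite divr_ge0 ?(ltW v0)//= ler_pdivrMr// mul1r.
have Bv0 : 0 < B `^ v by rewrite powR_gt0.
have pw w : h w `^ u <= B `^ u * (1 - u / v) + B `^ u * (u / v) / B `^ v * h w `^ v.
  have -> : h w `^ u = B `^ u * ((h w / B) `^ v) `^ (u / v).
    rewrite -powRrM [v * _]mulrC divfK ?gt_eqF// -powRM ?divr_ge0 ?(ltW B0)//.
    by rewrite [B * _]mulrC divfK// gt_eqF.
  have -> : h w `^ v = B `^ v * (h w / B) `^ v.
    rewrite -powRM ?divr_ge0 ?(ltW B0)//.
    by rewrite [B * _]mulrC divfK// gt_eqF.
  have := powR_le_tangent1 (powR_ge0 (h w / B) v) k01.
  have Bu0 : 0 < B `^ u by rewrite powR_gt0.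
  rewrite -(ler_pM2l Bu0) => /le_trans; apply.
  rewrite le_eqVlt; apply/orP; left; apply/eqP.
  by field; rewrite !gt_eqF.
have v0' := ltW v0.
have bv : bmf (fun w => h w `^ v) by exact: bmf_powR.
apply: le_trans (_ : \int[P]_w (B `^ u * (1 - u / v) +
   B `^ u * (u / v) / B `^ v * h w `^ v) <= _).
  apply: le_integral_bmf; first exact: bmf_powR.
    by apply: bmfD; [exact: bmf_cst|exact: bmfZ].
  exact/aeW.
rewrite integral_bmfD; [|exact: bmf_cst|exact: bmfZ].
rewrite integral_prob_cst integral_bmfZ//.
have c0 : 0 <= B `^ u * (u / v) / B `^ v.
  by rewrite mulr_ge0 ?invr_ge0 ?powR_ge0// mulr_ge0 ?powR_ge0//; case/andP: k01.
have := ler_wpM2l c0 hB; rewrite divfK ?gt_eqF//; lra.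
Qed.

(** With [m = q / 2], [K = kappa_q q B] and [a = (1 - 1/q)^m], the leading term
    is at most [a K^m] and Young's inequality bounds the other one by
    [(1 - a)/m (K^m + (m - 1) E y^q)].  The two bounds add up to [K^m] when
    [E y^q = K^m], and the coefficient of [E y^q] in them is less than 1. *)
Lemma moment_step (R : realType) d (Omega : measurableType d)
    (P : probability Omega R) (y V : Omega -> R) (B q : R) :
  bmf y -> (forall w, 0 < y w) ->
  bmf V -> (forall w, 0 <= V w) -> 0 < B -> 2 <= q ->
  \int[P]_w (y w `^ q) <= (\int[P]_w (y w `^ (q - 1))) `^ (q / (q - 1)) +
      q / 2 * \int[P]_w (V w * y w `^ (q - 2)) ->
  \int[P]_w (V w `^ (q / 2)) <= B `^ (q / 2) ->
  \int[P]_w (y w `^ (q - 1)) <= (kappa_ q * (q - 1) * B) `^ ((q - 1) / 2) ->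
  \int[P]_w (y w `^ q) <= (kappa_ q * q * B) `^ (q / 2).
Proof.
move=> by_ y0 bV V0 B0 q2 rec hV low.
have k0 := kappa_gt0 q2.
have q0 : 0 < q by clear -q2; lra.
have q1 : 0 < q - 1 by clear -q2; lra.
have q20 : 0 <= q - 2 by rewrite subr_ge0.
set m := q / 2 in hV *.
have m1 : 1 <= m by rewrite /m; clear -q2; lra.
have m0 : 0 < m := lt_le_trans ltr01 m1.
set K := kappa_ q * q * B; have K0 : 0 < K.
  by rewrite /K; do 2?[apply: mulr_gt0 => //].
set S := \int[P]_w (y w `^ q) in rec *.
set I := \int[P]_w (V w * y w `^ (q - 2)) in rec *.
have Km0 : 0 < K `^ m by rewrite powR_gt0.
have bq : bmf (fun w => y w `^ q) by apply: bmf_powR => //; exact: ltW.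
have bm : bmf (fun w => V w `^ m) by apply: bmf_powR => //; exact: ltW.
have bI : bmf (fun w => V w * y w `^ (q - 2)).
  by apply: bmfM => //; exact: bmf_powR.
pose c := K / B.
have c0 : 0 < c by rewrite divr_gt0.
(* Young's inequality for the exponent [m], at [c V] and [y ^ 2] *)
have young : m * c * I <= K `^ m + (m - 1) * S.
  have pw w : m * c * (V w * y w `^ (q - 2)) <=
      c `^ m * V w `^ m + (m - 1) * y w `^ q.
    have cV0 : 0 <= c * V w by rewrite mulr_ge0// ltW.
    have y20 : 0 < y w `^ 2 by rewrite powR_gt0.
    have := powR_ge_tangent cV0 y20 m1.
    rewrite powRM ?(ltW c0)// -!powRrM.
    have -> : 2 * m = q by rewrite /m; field.
    have -> : 2 * (m - 1) = q - 2 by rewrite /m; field.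
    have -> : y w `^ q = y w `^ 2 * y w `^ (q - 2).
      rewrite -powRD ?(gt_eqF (y0 w)) ?implybT//.
      by congr (_ `^ _); ring.
    set a := (c * V w) `^ m; set b := y w `^ (q - 2); set z := y w `^ 2.
    clear; lra.
  rewrite /I -integral_bmfZ//.
  apply: le_trans (_ : \int[P]_w (c `^ m * V w `^ m + (m - 1) * y w `^ q) <= _).
    apply: le_integral_bmf; [exact: bmfZ| |exact/aeW].
    by apply: bmfD; exact: bmfZ.
  rewrite integral_bmfD ?integral_bmfZ//; try exact: bmfZ.
  rewrite lerD2r; have -> : K `^ m = c `^ m * B `^ m.
    by rewrite -powRM ?(ltW c0) ?(ltW B0)// divfK// gt_eqF.
  by rewrite ler_pM2l// powR_gt0.
have lead : (\int[P]_w (y w `^ (q - 1))) `^ (q / (q - 1)) <=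
    (1 - q^-1) `^ m * K `^ m.
  have e : 0 <= q / (q - 1) by rewrite divr_ge0// ltW.
  have := @ge0_ler_powR _ (q / (q - 1)) e _ _ _ _ low; rewrite !nnegrE powR_ge0.
  have -> : 0 <= \int[P]_w (y w `^ (q - 1)).
    by apply: Rintegral_ge0 => w _; exact: powR_ge0.
  move=> /(_ isT isT) /le_trans; apply.
  rewrite -powRrM -powRM ?(ltW K0)//; last first.
    by rewrite subr_ge0 invf_le1//; clear -q2; lra.
  have -> : (q - 1) / 2 * (q / (q - 1)) = m.
    by rewrite /m; field; rewrite gt_eqF.
  have -> : kappa_ q * (q - 1) * B = (1 - q^-1) * K.
    by rewrite /K; field; rewrite gt_eqF.
  exact: lexx.
set a := (1 - q^-1) `^ m in lead.
have a1 : a < 1 by exact: kappa_base_lt1.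
have ah : 2^-1 <= a by exact: kappa_base_ge.
have cE : c = m / (1 - a).
  rewrite /c /K /kappa_ -/m -/a /m; field.
  by rewrite (gt_eqF B0)/= subr_eq0 gt_eqF.
have mI : m * I <= (1 - a) / m * (K `^ m + (m - 1) * S).
  have k1 : 0 <= (1 - a) / m by rewrite divr_ge0 ?(ltW m0)// subr_ge0 ltW.
  have := ler_wpM2l k1 young; rewrite cE.
  have -> : (1 - a) / m * (m * (m / (1 - a)) * I) = m * I.
    by field; rewrite (gt_eqF m0)/= subr_eq0 gt_eqF.
  by [].
set Km := K `^ m in Km0 lead mI *.
have : S <= a * Km + (1 - a) / m * (Km + (m - 1) * S).
  exact: le_trans rec (lerD lead mI).
set l := (1 - a) / m in mI *.
have l0 : 0 < l by rewrite divr_gt0// subr_gt0.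
have lm : l * m = 1 - a by rewrite /l divfK// gt_eqF.
have -> : l * (Km + (m - 1) * S) = l * Km + (l * m) * S - l * S by ring.
rewrite lm => h.
have : (a + l) * S <= (a + l) * Km by clear -h; lra.
by rewrite ler_pM2l// addr_gt0// (lt_le_trans _ ah).
Qed.

(** Induction on the integer part of [q]: the moment of order [q - 1] is given
    by the induction hypothesis as long as [q - 1 >= 2], and by the second
    moment below that.  The bound survives the change of [kappa_ (q - 1)] into
    [kappa_ q] because [kappa_] is nondecreasing and at least 1. *)
Lemma moment_bound (R : realType) d (Omega : measurableType d)
    (P : probability Omega R) (y V : Omega -> R) (B : R) :
  bmf y -> (forall w, 0 < y w) ->
  bmf V -> (forall w, 0 <= V w) -> 0 < B ->
  (forall s : R, 2 <= s -> \int[P]_w (y w `^ s) <=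
    (\int[P]_w (y w `^ (s - 1))) `^ (s / (s - 1)) +
      s / 2 * \int[P]_w (V w * y w `^ (s - 2))) ->
  \int[P]_w (y w `^ 2) <= B ->
  forall q : R, 2 <= q -> \int[P]_w (V w `^ (q / 2)) <= B `^ (q / 2) ->
  \int[P]_w (y w `^ q) <= (kappa_ q * q * B) `^ (q / 2).
Proof.
move=> by_ y0 bV V0 B0 rec base.
suff main (k : nat) (r : R) : 2 <= r -> r <= k%:R + 3 ->
    \int[P]_w (V w `^ (r / 2)) <= B `^ (r / 2) ->
    \int[P]_w (y w `^ r) <= (kappa_ r * r * B) `^ (r / 2).
  move=> q q2; apply: (main (Num.truncn q)) => //.
  by have := truncnS_gt q; rewrite -natr1; clear; lra.
have small (q : R) : 2 <= q -> q <= 3 ->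
    \int[P]_w (y w `^ (q - 1)) <= (kappa_ q * (q - 1) * B) `^ ((q - 1) / 2).
  move=> q2 q3; have kq1 := kappa_ge1 q2.
  have y2 w : y w `^ (q - 1) = (y w `^ 2) `^ ((q - 1) / 2).
    by rewrite -powRrM; congr (_ `^ _); field.
  under eq_Rintegral do rewrite y2.
  apply: (@le_trans _ _ (B `^ ((q - 1) / 2))).
    apply: (@lyapunov _ _ _ _ _ B _ 1) => //.
    - exact: bmf_powR.
    - by move=> w; exact: powR_ge0.
    - by clear -q2; lra.
    - by clear -q3; lra.
    under eq_Rintegral do rewrite powRr1 ?powR_ge0//.
    by rewrite powRr1// ltW.
  have q1 : 1 <= q - 1 by clear -q2; lra.
  have k1 : 1 <= kappa_ q * (q - 1) by rewrite -[leLHS]mulr1; exact: ler_pM.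
  apply: ge0_ler_powR; rewrite ?nnegrE.
  - by clear -q2; lra.
  - exact: ltW.
  - by rewrite mulr_ge0 ?(ltW B0)// (le_trans ler01).
  by rewrite -[leLHS]mul1r ler_pM2r.
elim: k r => [|k ih] q q2 qk hV.
  apply: (moment_step by_ y0 bV V0 B0 q2 (rec _ q2) hV) => //.
  by apply: small => //; clear -qk; lra.
have [q3|q3] := leP q 3.
  by apply: (moment_step by_ y0 bV V0 B0 q2 (rec _ q2) hV) => //; exact: small.
have q1 : 2 <= q - 1 by clear -q3; lra.
have qm1 : 0 < q - 1 := lt_le_trans (ltr0n R 2) q1.
apply: (moment_step by_ y0 bV V0 B0 q2 (rec _ q2) hV) => //.
have hV' : \int[P]_w (V w `^ ((q - 1) / 2)) <= B `^ ((q - 1) / 2).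
  apply: (@lyapunov _ _ _ _ _ B _ (q / 2)) => //.
  - by clear -q1; lra.
  - by clear; lra.
  - by clear -q2; lra.
apply: le_trans (ih _ q1 _ hV') _; first by move: qk; rewrite -natr1; clear; lra.
have kq1 := kappa_ge1 q2; have kq0 := kappa_gt0 q1.
have kq0' : 0 < kappa_ q := lt_le_trans ltr01 kq1.
apply: ge0_ler_powR; rewrite ?nnegrE.
- by clear -q1; lra.
- by apply: mulr_ge0; [apply: mulr_ge0|]; exact: ltW.
- by apply: mulr_ge0; [apply: mulr_ge0|]; exact: ltW.
rewrite ler_pM2r// ler_pM2r//; apply: kappa_le => //.
by clear; lra.
Qed.

(** * The inequality for bounded functions *)

Section bounded_case.
Context (R : realType) d d' (Omega : measurableType d) (E : measurableType d')
  (P : probability Omega R) (n : nat) (X : 'I_n -> {RV P >-> E}).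
Hypothesis X_indep : independent_RVs X.
Variables (F : n.-tuple E -> R) (G : 'I_n -> n.-tuple E -> R).
Hypotheses (bF : bmf F) (bG : forall i, bmf (G i)).
Hypothesis G_inv : forall i x t, G i (upd i x t) = G i t.

Let J : Omega -> n.-tuple E := joint X.
Let V w := \sum_(i < n) (F (J w) - G i (J w)) ^+ 2.

Lemma bmf_sqr (h : n.-tuple E -> R) : bmf h -> bmf (fun t => h t ^+ 2).
Proof.
by move=> bh; under eq_fun do rewrite expr2; exact: bmfM.
Qed.

Let bV : bmf V.
Proof.
have b := bmf_joint X (f := fun t => \sum_(i < n) (F t - G i t) ^+ 2).
by apply: b; apply: bmf_sum => i; apply: bmf_sqr; exact: bmfB.
Qed.

Lemma bmf_max (h : n.-tuple E -> R) (m e : R) : bmf h ->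
  bmf (fun t => Num.max (h t - m) e).
Proof.
move=> bh; have [mh [B hB]] := bmfB bh (bmf_cst _ m); split.
  exact: measurable_maxr.
exists (B + `|e|) => t.
have hB' := hB t; have B0 := le_trans (normr_ge0 _) hB'.
case: (leP (h t - m) e) => _; last by rewrite (le_trans hB')// lerDl.
by rewrite lerDr.
Qed.

(** For [p = 2] the divergence is a squared difference.  Adding a constant [M]
    makes all functions at least 1, as the tensorization requires, and changes
    neither side. *)
Lemma efron_stein (m : R) : m = \int[P]_w F (J w) ->
  \int[P]_w ((F (J w) - m) ^+ 2) <= \int[P]_w V w.
Proof.
move=> mE.
have [_ [B FB]] := bF.
have [C GC] : exists C : R, forall i t, `|G i t| <= C.
  have /choice[c cG] : forall i, exists c, forall t, `|G i t| <= c.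
    by move=> i; case: (bG i).
  exists (\sum_i `|c i|) => i t; apply: (le_trans (cG i t)).
  rewrite (bigD1 i)//= -[leLHS]addr0 lerD ?ler_norm//.
  exact: sumr_ge0.
pose M := `|B| + `|C| + 1.
have FM t : 1 <= F t + M.
  have := FB t; rewrite ler_norml => /andP[h _]; rewrite /M.
  by have := ler_norm B; have := normr_ge0 C; lra.
have GM i t : 1 <= G i t + M.
  have := GC i t; rewrite ler_norml => /andP[h _]; rewrite /M.
  by have := ler_norm C; have := normr_ge0 B; lra.
have bFM : bmf (fun t => F t + M) by apply: bmfD => //; exact: bmf_cst.
have bGM i : bmf (fun t => G i t + M) by apply: bmfD => //; exact: bmf_cst.
have p12 : 1 < (2 : R) <= 2 by lra.
have inv i x t : G i (upd i x t) + M = G i t + M by rewrite G_inv.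
have := entropy_tensorization X_indep p12 ltr01 bFM bGM FM GM inv.
rewrite -/J.
have bJ := bmf_joint X bF; rewrite -/J in bJ.
have -> : \sum_(i < n) \int[P]_w breg 2 (F (J w) + M) (G i (J w) + M) =
    \int[P]_w V w.
  rewrite -integral_bmf_sum; last first.
    move=> i; apply: (bmf_joint X (f := fun t => breg 2 (F t + M) (G i t + M))).
    by apply: bmf_breg => //; lra.
  apply: eq_Rintegral => w _; apply: eq_bigr => i _; rewrite /breg.
  have -> : (2 : R) - 1 = 1 by lra.
  have f0 : 0 <= F (J w) + M by have := FM (J w); lra.
  have g0 : 0 <= G i (J w) + M by have := GM i (J w); lra.
  by rewrite !(powR_mulrn 2)// powRr1//; ring.
under eq_Rintegral => w _.
  rewrite (powR_mulrn 2); last by have := FM (J w); lra.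
  over.
rewrite integral_bmfD; [|exact: bJ|exact: bmf_cst].
rewrite integral_prob_cst -mE.
have mM : 0 <= m + M.
  rewrite -(integral_prob_cst P M) mE -integral_bmfD//; last exact: bmf_cst.
  by apply: Rintegral_ge0 => w _; have := FM (J w); lra.
rewrite (powR_mulrn 2)// => h.
have -> : \int[P]_w (F (J w) - m) ^+ 2 =
    \int[P]_w ((F (J w) + M) ^+ 2 - (2 * (m + M) * F (J w) + (M ^+ 2 - m ^+ 2))).
  by apply: eq_Rintegral => w _; ring.
rewrite integral_bmfB; last 2 first.
- by apply: (bmf_joint X (f := fun t => (F t + M) ^+ 2)); exact: bmf_sqr.
- by apply: bmfD; [exact: bmfZ|exact: bmf_cst].
rewrite integral_bmfD; [|exact: bmfZ|exact: bmf_cst].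
by rewrite integral_prob_cst integral_bmfZ// -mE; lra.
Qed.

Hypothesis GF : forall i, {ae P, forall w, G i (J w) <= F (J w)}.

(** Tensorization of the power [s - 1] of the part above the level [e], for the
    exponent [s / (s - 1)]; the level [e] keeps all the functions away
    from 0. *)
Lemma moment_recursion (m e s : R) : 0 < e -> 2 <= s ->
  \int[P]_w (Num.max (F (J w) - m) e `^ s) <=
   (\int[P]_w (Num.max (F (J w) - m) e `^ (s - 1))) `^ (s / (s - 1)) +
     s / 2 * \int[P]_w (V w * Num.max (F (J w) - m) e `^ (s - 2)).
Proof.
move=> e0 s2.
pose y t := Num.max (F t - m) e; pose x i t := Num.max (G i t - m) e.
have ye t : e <= y t by rewrite /y le_max lexx orbT.
have xe i t : e <= x i t by rewrite /x le_max lexx orbT.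
have by_ : bmf y by exact: bmf_max.
have bx i : bmf (x i) by exact: bmf_max.
have s1 : 0 <= s - 1 by lra.
have s22 : 0 <= s - 2 by lra.
have p12 : 1 < s / (s - 1) <= 2.
  by rewrite ltr_pdivlMr ?ler_pdivrMr; lra.
have up t : e <= t -> e `^ (s - 1) <= t `^ (s - 1).
  by move=> et; apply: ge0_ler_powR; rewrite ?nnegrE; lra.
have inv i u t : x i (upd i u t) `^ (s - 1) = x i t `^ (s - 1) by rewrite /x G_inv.
have := @entropy_tensorization _ _ _ _ _ _ _ _ X_indep (fun t => y t `^ (s - 1))
  (fun i t => x i t `^ (s - 1)) (s / (s - 1)) (e `^ (s - 1)) p12
  (powR_gt0 _ e0) (bmf_powR s1 by_) (fun i => bmf_powR s1 (bx i))
  (fun t => up _ (ye t)) (fun i t => up _ (xe i t)) inv.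
rewrite -/J.
under eq_Rintegral => w _.
  rewrite -powRrM (_ : (s - 1) * (s / (s - 1)) = s); last first.
    by field; rewrite gt_eqF//; lra.
  over.
move=> /le_trans; apply; rewrite lerD2l.
have bterm i : bmf (fun w =>
    s / 2 * ((F (J w) - G i (J w)) ^+ 2 * y (J w) `^ (s - 2))).
  apply: (bmf_joint X
    (f := fun t => s / 2 * ((F t - G i t) ^+ 2 * y t `^ (s - 2)))).
  apply/bmfZ/bmfM; last exact: bmf_powR.
  by apply: bmf_sqr; exact: bmfB.
have -> : s / 2 * \int[P]_w (V w * Num.max (F (J w) - m) e `^ (s - 2)) =
    \sum_(i < n) \int[P]_w
      (s / 2 * ((F (J w) - G i (J w)) ^+ 2 * y (J w) `^ (s - 2))).
  rewrite -integral_bmf_sum// -integral_bmfZ; last first.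
    apply: (bmfM bV); apply: bmf_powR => //.
    exact: (bmf_joint X by_).
  by apply: eq_Rintegral => w _; rewrite -mulr_sumr -mulr_suml.
apply: ler_sum => i _; apply: le_integral_bmf => //.
  apply: (bmf_joint X (f := fun t =>
    breg (s / (s - 1)) (y t `^ (s - 1)) (x i t `^ (s - 1)))).
  by apply: bmf_breg; [lra|exact: bmf_powR..].
apply: filterS (GF i) => w gf.
have xy : x i (J w) <= y (J w).
  by rewrite /x /y ge_max !le_max lexx orbT andbT lerB.
have x0 : 0 < x i (J w) <= y (J w) by rewrite xy andbT (lt_le_trans e0).
apply: (le_trans (breg_powR_le s2 x0)).
rewrite ler_pM2l; last by lra.
rewrite ler_wpM2r ?powR_ge0// ler_sqr ?nnegrE ?subr_ge0//.
move: gf; rewrite /x /y; case: (leP (G i (J w) - m) e) => ?;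
  case: (leP (F (J w) - m) e) => ?; lra.
Qed.

(** [moment_bound] for the part above the level [e], with [B = A + 2 e^2]: one
    [e^2] makes [A] positive, the other pays for the level in the second
    moment.  Then [e] tends to 0. *)
Lemma moment_inequality_bounded (m q A : R) : m = \int[P]_w F (J w) ->
  2 <= q -> 0 <= A ->
  \int[P]_w (V w `^ (q / 2)) <= A `^ (q / 2) ->
  \int[P]_w (Num.max (F (J w) - m) 0 `^ q) <= (kappa_ q * q * A) `^ (q / 2).
Proof.
move=> mE q2 A0 hV.
have k0 := kappa_gt0 q2.
have V0 w : 0 <= V w by apply: sumr_ge0 => i _; exact: sqr_ge0.
have q0 : 0 < q := lt_le_trans (ltr0n R 2) q2.
have q20 : 0 < q / 2 by rewrite divr_gt0.
set S := \int[P]_w _.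
have S0 : 0 <= S by apply: Rintegral_ge0 => w _; exact: powR_ge0.
have eps_bound e : 0 < e -> S <= (kappa_ q * q * (A + 2 * e ^+ 2)) `^ (q / 2).
  move=> e0; set B := A + 2 * e ^+ 2.
  have e20 : 0 < e ^+ 2 by rewrite exprn_gt0.
  have B0 : 0 < B by rewrite /B; lra.
  pose y w := Num.max (F (J w) - m) e.
  have ye w : e <= y w by rewrite /y le_max lexx orbT.
  have by_ : bmf y by exact: (bmf_joint X (bmf_max m e bF)).
  have hVB C : A <= C -> \int[P]_w (V w `^ (q / 2)) <= C `^ (q / 2).
    by move=> AC; apply: (le_trans hV); apply: ge0_ler_powR; rewrite ?nnegrE; lra.
  have base : \int[P]_w (y w `^ 2) <= B.
    have EV : \int[P]_w V w <= A + e ^+ 2.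
      have -> : \int[P]_w V w = \int[P]_w (V w `^ 1).
        by apply: eq_Rintegral => w _; rewrite powRr1.
      rewrite -[leRHS]powRr1; last by lra.
      apply: (lyapunov bV V0 _ _ _ q20); try lra.
      by apply: hVB; lra.
    apply: (@le_trans _ _ (\int[P]_w ((F (J w) - m) ^+ 2 + e ^+ 2))).
      apply: le_integral_bmf.
      - exact: bmf_powR.
      - apply: bmfD; last exact: bmf_cst.
        apply: (bmf_joint X (f := fun t => (F t - m) ^+ 2)).
        by apply: bmf_sqr; apply: bmfB => //; exact: bmf_cst.
      - apply/aeW => w; rewrite (powR_mulrn 2); last first.
          by have := ye w; lra.
        rewrite /y; case: (leP (F (J w) - m) e) => _.
          by rewrite lerDr sqr_ge0.
        by rewrite lerDl sqr_ge0.
    rewrite integral_bmfD ?integral_prob_cst; last 2 first.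
    - apply: (bmf_joint X (f := fun t => (F t - m) ^+ 2)).
      by apply: bmf_sqr; apply: bmfB => //; exact: bmf_cst.
    - exact: bmf_cst.
    by have := efron_stein mE; rewrite /B; lra.
  have y0 w : 0 < y w by exact: lt_le_trans e0 _.
  have := @moment_bound _ _ _ P y V B by_ y0 bV V0 B0.
  move=> /(_ (fun s s2 => moment_recursion m e0 s2) base q q2).
  have AB : A <= B by rewrite /B lerDl mulr_ge0// ltW.
  move=> /(_ (hVB _ AB)); apply: le_trans; apply: le_integral_bmf.
  - apply: bmf_powR; first exact: ltW.
    exact: (bmf_joint X (bmf_max m 0 bF)).
  - by apply: bmf_powR => //; exact: ltW.
  - apply/aeW => w; apply: ge0_ler_powR; rewrite ?nnegrE; first exact: ltW.
    + by rewrite le_max lexx orbT.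
    + exact/ltW.
    + by rewrite /y ge_max !le_max lexx/= (ltW e0) orbT.
have SE : S = (S `^ (2 / q)) `^ (q / 2).
  rewrite -powRrM (_ : 2 / q * (q / 2) = 1) ?powRr1//.
  by field; rewrite gt_eqF//; lra.
rewrite SE; apply: ge0_ler_powR; rewrite ?nnegrE ?powR_ge0//; first by lra.
  by do 2?[apply: mulr_ge0]; lra.
apply/ler_addgt0Pr => u u0.
have kq0 : 0 < kappa_ q * q by rewrite mulr_gt0//; lra.
pose e := Num.sqrt (u / (2 * (kappa_ q * q))).
have u'0 : 0 < u / (2 * (kappa_ q * q)) by rewrite divr_gt0// mulr_gt0.
have e0 : 0 < e by rewrite sqrtr_gt0.
have qi : 0 <= 2 / q by rewrite divr_ge0//; lra.
have := ge0_ler_powR qi _ _ (eps_bound e e0); rewrite !nnegrE S0 powR_ge0.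
move=> /(_ isT isT) /le_trans; apply.
rewrite -powRrM (_ : q / 2 * (2 / q) = 1); last by field; rewrite gt_eqF//; lra.
rewrite sqr_sqrtr; last exact: ltW.
rewrite powRr1; last first.
  by rewrite mulr_ge0 ?(ltW kq0)//; have := ltW u'0; lra.
rewrite le_eqVlt; apply/orP; left; apply/eqP.
by field; rewrite !gt_eqF//; lra.
Qed.

End bounded_case.

(** * Removing the boundedness *)

Section clipping.
Context (R : realType).
Implicit Types k x y : R.

Definition clip k x : R := Num.max (- k) (Num.min x k).

Lemma normr_clip k x : 0 <= k -> `|clip k x| <= k.
Proof.
move=> k0; rewrite /clip ler_norml le_max lexx/= ge_max ge_min lexx orbT andbT.
by lra.
Qed.

Lemma clip_id k x : `|x| <= k -> clip k x = x.
Proof.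
by rewrite ler_norml => /andP[h1 h2]; rewrite /clip min_l// max_r.
Qed.

Lemma normr_clip_le_id k x : 0 <= k -> `|clip k x| <= `|x|.
Proof.
move=> k0; have [xk|kx] := leP `|x| k; first by rewrite clip_id.
by apply: le_trans (ltW kx); exact: normr_clip.
Qed.

Lemma clip_homo k x y : x <= y -> clip k x <= clip k y.
Proof.
move=> xy; rewrite /clip ge_max le_max lexx/= le_max; apply/orP; right.
by rewrite le_min !ge_min xy lexx orbT.
Qed.

Lemma clip_dist k x y : 0 <= k -> (clip k x - clip k y) ^+ 2 <= (x - y) ^+ 2.
Proof.
move=> k0; wlog xy : x y / x <= y.
  move=> h; have [xy|/ltW yx] := leP x y; first exact: h.
  have e (u v : R) : (u - v) ^+ 2 = (v - u) ^+ 2 by ring.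
  by rewrite e [leRHS]e; exact: h.
have cxy := clip_homo k xy.
have e (u v : R) : (u - v) ^+ 2 = (v - u) ^+ 2 by ring.
rewrite e [leRHS]e ler_sqr ?nnegrE ?subr_ge0//.
rewrite lerBlDr {1}/clip ge_max; apply/andP; split.
  have : - k <= clip k x by rewrite /clip le_max lexx.
  by lra.
have xk : Num.min x k <= clip k x by rewrite /clip le_max lexx orbT.
rewrite -lerBlDl; apply: le_trans xk; rewrite le_min !lerBlDl !ge_min.
by rewrite subrK lexx/= lerDr subr_ge0 xy orbT.
Qed.

Lemma measurable_clip d (T : measurableType d) k (f : T -> R) :
  measurable_fun setT f -> measurable_fun setT (fun t => clip k (f t)).
Proof.
by move=> mf; apply: measurable_maxr => //; exact: measurable_minr.
Qed.

Lemma clip_cvg x : clip n%:R x @[n --> \oo] --> x.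
Proof.
apply: cvg_near_cst; near=> n; apply: clip_id; near: n.
exact: nbhs_infty_ger.
Unshelve. all: by end_near. Qed.

End clipping.

(** At a positive limit the power is differentiable; at 0 it is squeezed between
    0 and the identity. *)
Lemma cvg_powR (R : realType) (u : nat -> R) (l q : R) : 1 <= q ->
  (forall n, 0 <= u n) -> u n @[n --> \oo] --> l ->
  u n `^ q @[n --> \oo] --> l `^ q.
Proof.
move=> q1 u0 ul.
have l0 : 0 <= l.
  rewrite -(cvg_lim (@Rhausdorff R) ul); apply: limr_ge.
    exact: cvgP ul.
  exact: nearW.
move: l0; rewrite le_eqVlt => /predU1P[l0|l0].
  rewrite -l0 in ul *; rewrite powR0 ?gt_eqF//; last by lra.
  apply: (squeeze_cvgr (f := fun=> 0) (h := u) _ (cvg_cst _) ul).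
  near=> n; rewrite powR_ge0/=.
  have : u n < 1 by near: n; exact: (cvgr_lt 0 ul).
  have := u0 n; rewrite le_eqVlt => /predU1P[<- _|un0 un1].
    by rewrite powR0 ?gt_eqF//; lra.
  by apply: ge1r_powR => //; rewrite un0 ltW.
have c : {for l, continuous (fun x : R => x `^ q)}.
  apply: differentiable_continuous; apply/derivable1_diffP.
  by apply: derivable_powR; rewrite in_itv/= l0.
exact: (cvg_comp _ _ ul c).
Unshelve. all: by end_near. Qed.

Section truncation.
Context (R : realType) d d' (Omega : measurableType d) (E : measurableType d')
  (P : probability Omega R) (n : nat) (X : 'I_n -> {RV P >-> E}).
Hypothesis X_indep : independent_RVs X.
Variables (F : n.-tuple E -> R) (G : 'I_n -> n.-tuple E -> R).
Hypotheses (mF : measurable_fun setT F) (mG : forall i, measurable_fun setT (G i)).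
Hypothesis G_inv : forall i x t, G i (upd i x t) = G i t.

Let J : Omega -> n.-tuple E := joint X.
Let V w := \sum_(i < n) (F (J w) - G i (J w)) ^+ 2.

Hypothesis F_int : P.-integrable setT (EFin \o (F \o J)).
Hypothesis GF : forall i, {ae P, forall w, G i (J w) <= F (J w)}.

Let mJ : measurable_fun setT J.
Proof. by apply: measurable_joint => i; exact: measurable_funP. Qed.

Let mFJ : measurable_fun setT (F \o J). Proof. exact: measurableT_comp. Qed.

Let bmf_clip k f : measurable_fun setT f -> 0 <= k ->
  bmf (fun t : n.-tuple E => clip k (f t) : R).
Proof.
move=> mf k0; split; first exact: measurable_clip.
by exists k => t; exact: normr_clip.
Qed.

(** Clipping to [-k, k] is nondecreasing and 1-Lipschitz, so that the clipped
    functions satisfy the bounded inequality with the same [A]; their means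
    converge by dominated convergence. *)
Lemma moment_inequality (q A : R) : 2 <= q -> 0 <= A ->
  (\int[P]_w (V w `^ (q / 2))%:E <= (A `^ (q / 2))%:E)%E ->
  (\int[P]_w (Num.max (F (J w) - \int[P]_w F (J w)) 0 `^ q)%:E <=
    ((kappa_ q * q * A) `^ (q / 2))%:E)%E.
Proof.
move=> q2 A0 hV; set m := \int[P]_w F (J w).
pose Fk (k : nat) t := clip k%:R (F t).
pose Gk (k : nat) i t := clip k%:R (G i t).
have bFk k : bmf (Fk k) by exact: bmf_clip.
have bGk k i : bmf (Gk k i) by exact: bmf_clip.
pose mk k := \int[P]_w Fk k (J w).
have V0 w : 0 <= V w by apply: sumr_ge0 => i _; exact: sqr_ge0.
have mV : measurable_fun setT V.
  apply: measurable_sum => i; apply: measurable_funX.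
  apply: measurable_funB => //.
  exact: (measurableT_comp (mG i)).
have step k : (\int[P]_w (Num.max (Fk k (J w) - mk k) 0 `^ q)%:E <=
    ((kappa_ q * q * A) `^ (q / 2))%:E)%E.
  have by_ : bmf (fun w => Num.max (Fk k (J w) - mk k) 0 `^ q).
    apply: bmf_powR; first by lra.
    exact: (bmf_joint X (bmf_max (mk k) 0 (bFk k))).
  rewrite -(fineK (integrable_fin_num measurableT (bmf_integrable P by_))) lee_fin.
  apply: (moment_inequality_bounded X_indep (bFk k) (bGk k)) => //.
  - by move=> i x t; rewrite /Gk G_inv.
  - by move=> i; apply: filterS (GF i) => w gf; exact: clip_homo.
  have bVk : bmf (fun w =>
      (\sum_(i < n) (Fk k (J w) - Gk k i (J w)) ^+ 2) `^ (q / 2)).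
    apply: bmf_powR; first by lra.
    apply: (bmf_joint X (f := fun t => \sum_(i < n) (Fk k t - Gk k i t) ^+ 2)).
    by apply: bmf_sum => i; apply: bmf_sqr; exact: bmfB.
  rewrite -lee_fin; apply: le_trans hV.
  rewrite /Rintegral fineK; last first.
    exact: (integrable_fin_num measurableT (bmf_integrable P bVk)).
  apply: ge0_le_integral => //.
  - by move=> w _; rewrite lee_fin powR_ge0.
  - by apply/measurable_EFinP; case: bVk.
  - apply/measurable_EFinP.
    exact: (measurableT_comp (measurable_powR _) mV).
  - move=> w _; rewrite lee_fin; apply: ge0_ler_powR; rewrite ?nnegrE.
    + by lra.
    + by apply: sumr_ge0 => i _; exact: sqr_ge0.
    + exact: V0.
    + by apply: ler_sum => i _; exact: clip_dist.
have mk_cvg : mk k @[k --> \oo] --> m.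
  have cvgZ : (\int[P]_w (Fk k (J w))%:E @[k --> \oo] --> \int[P]_w (F (J w))%:E)%E.
    apply: (@dominated_cvg _ _ _ P setT measurableT _ _
      (fun w => `|(F (J w))%:E|%E)).
    - move=> k; apply/measurable_EFinP.
      exact: (measurable_clip _ mFJ).
    - move=> w _; apply: cvg_EFin; first exact: nearW.
      exact: clip_cvg.
    - by [].
    - exact: (integrable_abse F_int).
    - by move=> k w _; rewrite lee_fin; exact: normr_clip_le_id.
  have mE : (\int[P]_w (F (J w))%:E = m%:E)%E.
    by rewrite /m /Rintegral fineK//; exact: (integrable_fin_num measurableT F_int).
  by rewrite mE in cvgZ; have [_ c] := (fine_cvgP _ _).1 cvgZ; exact: c.
have pt w : (Num.max (Fk k (J w) - mk k) 0 `^ q)%:E @[k --> \oo] -->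
     (Num.max (F (J w) - m) 0 `^ q)%:E.
  apply: cvg_EFin; first exact: nearW.
  apply: cvg_powR; first by lra.
    by move=> k; rewrite le_max lexx orbT.
  have c : Fk k (J w) - mk k @[k --> \oo] --> F (J w) - m.
    by apply: cvgB => //; exact: clip_cvg.
  under eq_fun do rewrite maxr_absE subr0 addr0.
  rewrite maxr_absE subr0 addr0.
  apply: cvgM; last exact: cvg_cst.
  by apply: cvgD => //; exact: cvg_norm.
apply: (@le_trans _ _ (limn_einf (fun k =>
    \int[P]_w (Num.max (Fk k (J w) - mk k) 0 `^ q)%:E)%E)).
  rewrite (eq_integral (fun w => limn_einf
    (fun k => (Num.max (Fk k (J w) - mk k) 0 `^ q)%:E))); last first.
    by move=> w _; rewrite (cvg_limn_einf_sup (pt w)).1.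
  apply: fatou => //.
  - move=> k; apply/measurable_EFinP.
    apply: (measurableT_comp (measurable_powR _)).
    apply: measurable_maxr => //.
    apply: measurable_funB => //; exact: (measurable_clip _ mFJ).
  - by move=> k w _; rewrite lee_fin powR_ge0.
rewrite limn_einf_lim; apply: lime_le; first exact: is_cvg_einfs.
apply: nearW => k; apply: le_trans (step k).
by apply: ereal_inf_lbound; exists k => /=.
Qed.

End truncation.

(** * The moment inequality *)

Definition drop_coord (E : Type) n (i : 'I_n) (t : n.-tuple E) : n.-1.-tuple E :=
  [tuple tnth t (lift i j) | j < n.-1].

Lemma drop_coord_joint (Omega E : Type) n (X : 'I_n -> Omega -> E) i w :
  drop_coord i (joint X w) = joint_without X i w.
Proof. by apply: eq_from_tnth => j; rewrite !tnth_mktuple. Qed.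

Lemma drop_coord_upd d (E : measurableType d) n (i : 'I_n) x (t : n.-tuple E) :
  drop_coord i (upd i x t) = drop_coord i t.
Proof.
apply: eq_from_tnth => j; rewrite !tnth_mktuple.
by rewrite eq_sym (negbTE (neq_lift i j)).
Qed.

Lemma measurable_drop_coord d (E : measurableType d) n (i : 'I_n) :
  measurable_fun setT (@drop_coord E n i).
Proof.
apply/measurable_fun_tnthP => j.
rewrite (_ : _ \o _ = (@tnth _ _ ^~ (lift i j))); first exact: measurable_tnth.
by apply/funext => t /=; rewrite tnth_mktuple.
Qed.

Theorem theorem3 (R : realType) (d d' : measure_display)
    (Omega : measurableType d) (E : measurableType d')
    (P : probability Omega R) (n : nat) (X : 'I_n -> {RV P >-> E})
    (F : n.-tuple E -> R) (F_ : 'I_n -> n.-1.-tuple E -> R)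
    (Z : Omega -> R) (Z_ : 'I_n -> Omega -> R) (V : Omega -> R)
    (X_indep : independent_RVs X)
    (F_meas : measurable_fun [set: n.-tuple E] F)
    (F__meas : forall i, measurable_fun [set: n.-1.-tuple E] (F_ i))
    (ZE : forall w, Z w = F (joint X w))
    (Z_E : forall i w, Z_ i w = F_ i (joint_without X i w))
    (VE : forall w, V w = \sum_(i < n) (Z w - Z_ i w) ^+ 2)
    (Z_int : P.-integrable [set: Omega] (EFin \o Z))
    (Z_le : forall i, {ae P, forall w, Z_ i w <= Z w})
    (q : R) (q_ge2 : 2 <= q) :
  ('N[P]_(q%:E)[(fun w => maxe ((Z w)%:E - 'E_P[Z]) 0)] <=
     sqrte ((kappa_ q * q)%:E * 'N[P]_((q / 2)%:E)[EFin \o V]) /\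
   sqrte ((kappa_ q * q)%:E * 'N[P]_((q / 2)%:E)[EFin \o V]) <=
     sqrte ((kappa R * q)%:E * 'N[P]_((q / 2)%:E)[EFin \o V]))%E.
Proof.
have q2 := q_ge2.
set N := ('N[P]_((q / 2)%:E)[EFin \o V])%E.
have q0 : 0 < q by lra.
have q20 : 0 < q / 2 by lra.
have kq0 : 0 < kappa_ q * q by rewrite mulr_gt0 ?kappa_gt0.
have kk := kappa_le_limit q2.
have kq0' : 0 < kappa R * q by rewrite mulr_gt0// (lt_le_trans (kappa_gt0 q2)).
have N0 : (0 <= N)%E by exact: Lnorm_ge0.
split; last first.
  rewrite lee_sqrt; last by rewrite mule_ge0// lee_fin ltW.
  by apply: lee_wpmul2r => //; rewrite lee_fin ler_pM2r.
have V0 w : 0 <= V w by rewrite VE; apply: sumr_ge0 => i _; exact: sqr_ge0.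
have NE : (N `^ (q / 2) = \int[P]_w (V w `^ (q / 2))%:E)%E.
  rewrite /N poweR_Lnorm; last by rewrite gt_eqF.
  apply: eq_integral => w _ /=.
  by rewrite ger0_norm.
case NA : N N0 NE => [A| |]// A0 NE; last first.
  by rewrite gt0_muley ?lte_fin//= leey.
rewrite lee_fin in A0.
pose G i t := F_ i (drop_coord i t).
have GE i w : G i (joint X w) = Z_ i w by rewrite Z_E /G drop_coord_joint.
have mG i : measurable_fun setT (G i).
  by apply: measurableT_comp => //; exact: measurable_drop_coord.
have Ginv i x t : G i (upd i x t) = G i t by rewrite /G drop_coord_upd.
have ZEf : Z = (fun w => F (joint X w)) by apply/funext.
have mean : ('E_P[Z] = (\int[P]_w F (joint X w))%:E)%E.
  rewrite unlock ZEf /Rintegral fineK//.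
  by rewrite ZEf in Z_int; exact: (integrable_fin_num measurableT Z_int).
have GF i : {ae P, forall w, G i (joint X w) <= F (joint X w)}.
  by apply: filterS (Z_le i) => w; rewrite GE ZE.
have F_int : P.-integrable setT (EFin \o (F \o joint X)) by rewrite ZEf in Z_int.
have hV : (\int[P]_w
    ((\sum_(i < n) (F (joint X w) - G i (joint X w)) ^+ 2) `^ (q / 2))%:E
    <= (A `^ (q / 2))%:E)%E.
  rewrite -poweR_EFin NE le_eqVlt; apply/orP; left; apply/eqP.
  apply: eq_integral => w _; rewrite VE; congr (_ `^ _)%:E.
  by apply: eq_bigr => i _; rewrite GE ZE.
have main := moment_inequality X_indep F_meas mG Ginv F_int GF q2 A0 hV.
rewrite mean unlock /=.
have K0 : 0 <= kappa_ q * q * A by rewrite mulr_ge0// ltW.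
have -> : (Num.sqrt (kappa_ q * q * A))%:E =
    ((((kappa_ q * q * A) `^ (q / 2))%:E) `^ q^-1)%E.
  rewrite poweR_EFin -powRrM -powR12_sqrt//; congr (_ `^ _)%:E.
  by field; rewrite gt_eqF.
apply: gt0_ler_poweR.
- by rewrite invr_ge0 ltW.
- by rewrite in_itv/= leey andbT; apply: integral_ge0 => w _; exact: poweR_ge0.
- by rewrite in_itv/= leey andbT lee_fin powR_ge0.
apply: le_trans main; rewrite le_eqVlt; apply/orP; left; apply/eqP.
apply: eq_integral => w _.
rewrite -EFinB -EFin_max ZE gee0_abs ?poweR_EFin//.
by rewrite lee_fin le_max lexx orbT.
Qed.
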